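(* Let $\mu$ be an $r$-Carleson measure on $[0,1)$ for some $r>1$. Then: (i) $H_\mu:H^\infty\to A(\mathbb{T})$ and $C_\mu:H^\infty\to A(\mathbb{T})$ are both well defined nuclear operators; (ii) $H_\mu:H^2\to H^2$ and $C_\mu:H^2\to H^2$ are both well defined compact operators, and $H_\mu$ on $H^2$ is self-adjoint; (iii) if $r>\frac32$, then $H_\mu:H^2\to A(\mathbb{T})$ and $C_\mu:H^2\to A(\mathbb{T})$ are both well defined nuclear operators.
   Context: Functions $f(z)=\sum_{n\ge0}a_nz^n$ holomorphic on the unit disc $\mathbb{D}$ are identified with their coefficient sequences $(a_n)$. $H^\infty$ is the space of bounded holomorphic functions on $\mathbb{D}$ with the sup norm; $H^2$ is the Hardy space, identified with $\ell^2_A=\{f:\sum|a_n|^2<\infty\}$; $A(\mathbb{T})$ is the Wiener algebra, identified with $\ell^1_A=\{f:\sum|a_n|<\infty\}$. For a positive finite Borel measure $\mu$ on $[0,1)$, $\mu_n=\int_0^1t^n\,d\mu(t)$; $\mu$ is $r$-Carleson if $\mu([t,1))=O((1-t)^r)$ as $t\to1^-$. On coefficient sequences, $H_\mu((a_n))=\left(\sum_{n=0}^\infty\mu_{n+k}a_n\right)_{k\ge0}$ and $C_\mu((a_n))=\left(\mu_k\sum_{n=0}^ka_n\right)_{k\ge0}$. An operator $T:X\to Y$ is nuclear if $T=\sum_nx_n^*(\cdot)y_n$ with $x_n^*\in X^*$, $y_n\in Y$, $\sum_n\|x_n^*\|\|y_n\|<\infty$. *)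

(* Defs.v *)
From HB Require Import structures.
From mathcomp Require Import all_boot all_order all_algebra.
From mathcomp Require Import all_classical all_reals all_analysis.
From mathcomp.real_closed Require Import complex.
Set Implicit Arguments. Unset Strict Implicit. Unset Printing Implicit Defensive.
Import Order.TTheory GRing.Theory Num.Theory.
Import numFieldNormedType.Exports.
Local Open Scope classical_set_scope.
Local Open Scope ring_scope.

Section Defs.
Variable R : realType.
Local Notation C := R[i].

Definition cabs (z : C) : R := Num.sqrt (complex.Re z ^+ 2 + complex.Im z ^+ 2).

Definition ccvg_to (u : nat -> C) (l : C) : Prop :=
  (fun n => cabs (u n - l)) @ \oo --> (0 : R).

Definition cseries_to (u : nat -> C) (l : C) : Prop :=
  ccvg_to (fun N => \sum_(n < N) u n) l.
Definition cseries_cvg (u : nat -> C) : Prop := exists l, cseries_to u l.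

(* the limit of a complex sequence (meaningful when it converges) *)
Definition clim (u : nat -> C) : C :=
  Complex (limn (fun n => complex.Re (u n))) (limn (fun n => complex.Im (u n))).
Definition csum (u : nat -> C) : C := clim (fun N => \sum_(n < N) u n).

(* ---- sequence spaces; functions are identified with coefficient sequences ---- *)

Definition disc : set C := [set z | cabs z < 1].

(* H^infty : the power series sum a_n z^n converges on the disc (so it defines
   a holomorphic function there) and the resulting function is bounded *)
Definition Hinf (a : nat -> C) : Prop :=
  (forall z, disc z -> cseries_cvg (fun n => a n * z ^+ n)) /\
  exists M : R, forall z l, disc z -> cseries_to (fun n => a n * z ^+ n) l ->
    cabs l <= M.
Definition Hinf_norm (a : nat -> C) : R :=
  fine (ereal_sup [set (cabs l)%:E | l in
     [set l | exists2 z, disc z & cseries_to (fun n => a n * z ^+ n) l]]).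

Definition l2sq (a : nat -> C) : \bar R := \sum_(0 <= n <oo) ((cabs (a n)) ^+ 2)%:E.
Definition H2 (a : nat -> C) : Prop := (l2sq a < +oo)%E.
Definition H2_norm (a : nat -> C) : R := Num.sqrt (fine (l2sq a)).

Definition l1e (a : nat -> C) : \bar R := \sum_(0 <= n <oo) (cabs (a n))%:E.
Definition AT (a : nat -> C) : Prop := (l1e a < +oo)%E.
Definition AT_norm (a : nat -> C) : R := fine (l1e a).

Definition H2_inner (a b : nat -> C) : C := csum (fun n => a n * conjc (b n)).

Definition unit_interval : set R := `[0%R, 1%R[%classic.

Definition moment (mu : {measure set R -> \bar R}) (n : nat) : R :=
  fine (\int[mu]_(t in unit_interval) (t ^+ n)%:E).

Definition carleson (mu : {measure set R -> \bar R}) (r : R) : Prop :=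
  exists (K t0 : R), t0 < 1 /\
    forall t, t0 <= t -> t < 1 -> (mu `[t, 1%R[%classic <= (K * (1 - t) `^ r)%:E)%E.

Definition Hmu_series (mu : {measure set R -> \bar R}) (a : nat -> C) (k : nat) :
  nat -> C := fun n => ((moment mu (n + k))%:C)%C * a n.
Definition Hmu (mu : {measure set R -> \bar R}) (a : nat -> C) : nat -> C :=
  fun k => csum (Hmu_series mu a k).
Definition Cmu (mu : {measure set R -> \bar R}) (a : nat -> C) : nat -> C :=
  fun k => ((moment mu k)%:C)%C * \sum_(n < k.+1) a n.

Definition maps_into (X Y : (nat -> C) -> Prop) (T : (nat -> C) -> nat -> C) :=
  forall a, X a -> Y (T a).

(* nuclear: T = sum_n x_n^*(.) y_n with x_n^* continuous linear functionals on X,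
   y_n in Y, sum_n ||x_n^*|| ||y_n|| < oo.  ||x_n^*|| <= c n is encoded by the
   bound |x_n^*(a)| <= c n ||a||_X; the series converges to T a in Y. *)
Definition nuclear (X : (nat -> C) -> Prop) (normX : (nat -> C) -> R)
  (Y : (nat -> C) -> Prop) (normY : (nat -> C) -> R)
  (T : (nat -> C) -> nat -> C) : Prop :=
  exists (phi : nat -> (nat -> C) -> C) (c : nat -> R) (y : nat -> nat -> C),
    (forall n a b (lam : C), X a -> X b ->
            phi n (fun k => a k + lam * b k) = phi n a + lam * phi n b) /\
    (forall n, 0 <= c n) /\
    (forall n a, X a -> cabs (phi n a) <= c n * normX a) /\
    (forall n, Y (y n)) /\
    (\sum_(0 <= n <oo) (c n * normY (y n))%:E < +oo)%E /\
    (forall a, X a ->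
       (fun N => normY (fun k => T a k - \sum_(n < N) phi n a * y n k))
         @ \oo --> (0 : R)).

Definition compact_H2 (T : (nat -> C) -> nat -> C) : Prop :=
  forall (a : nat -> nat -> C) (M : R),
    (forall j, H2 (a j) /\ H2_norm (a j) <= M) ->
    exists (s : nat -> nat) (b : nat -> C),
      (forall i j, (i < j)%N -> (s i < s j)%N) /\ H2 b /\
      (fun j => H2_norm (fun k => T (a (s j)) k - b k)) @ \oo --> (0 : R).

Definition selfadjoint_H2 (T : (nat -> C) -> nat -> C) : Prop :=
  forall a b, H2 a -> H2 b -> H2_inner (T a) b = H2_inner a (T b).

End Defs.

(* Main.v *)
(* With m_n the n-th moment of mu, cutting [0, 1) into the intervals
   [1 - (j+1)/(n+1), 1 - j/(n+1)) gives m_n = O((n+1)^-r).  On H^2 both operators then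
   have matrix entries at most C (k+1)^-p (n+1)^-q for any p + q = r, so
   |(T a)_k| <= c_k ||a|| with c_k = O((k+1)^-p) as soon as q > 1/2: for p = q = r/2 the
   image of a ball lies in a Hilbert cube of l^2, and for p > 1 (possible iff r > 3/2)
   T = sum_k (T .)_k e_k is a nuclear decomposition.  On H^infty, Landau's argument
   bounds the partial sums of the coefficients by ||f|| sum_(n <= k) 1/(n+1); summation
   by parts against the decreasing m_n gives
   |(H a)_k| <= ||f|| sum_n m_(n+k)/(n+1), which is summable in k for every r > 1. *)
Require Import Defs.
From HB Require Import structures.
From mathcomp Require Import all_boot all_order all_algebra.
From mathcomp Require Import all_classical all_reals all_analysis.
From mathcomp.real_closed Require Import complex.
From mathcomp Require Import measurable_realfun separable cyclotomic zify ring lra.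
Import Order.TTheory GRing.Theory Num.Theory.
Import numFieldNormedType.Exports.
Local Open Scope classical_set_scope.
Local Open Scope ring_scope.
Set Implicit Arguments.
Unset Strict Implicit.
Unset Printing Implicit Defensive.

(** * The complex modulus *)

Section ComplexModulus.
Variable R : realType.
Implicit Types (z w : R[i]) (x : R).

(** For r close to 1 the partial sums of the coefficients of a bounded f must grow slower than any
    fixed power: the inclusion of H^infty in H^2 gives only O(sqrt(k+1)), which would ask for r >
    3/2 as in (iii). Landau's device is that (1 - z)^(-1/2) squares to 1/(1 - z). If p is its
    truncation at degree k, the k-th coefficient of f p^2 is a_0 + ... + a_k, and it is at most
    ||f|| times the circle mean of |p|^2, that is, ||f|| times the sum of the squared coefficients
    of p, each at most 1/(n+1). Contour integrals are avoided: circle means are averages over L-th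
    roots of unity, exact for polynomials of degree below L. For this reason f is truncated on a
    circle of radius s < 1; the truncation is removed first, then s tends to 1. *)

Lemma cabsE z : (cabs z)%:C%C = `|z|.
Proof. by case: z => a b; rewrite normc_def. Qed.

Lemma cabs_ge0 z : 0 <= cabs z. Proof. exact: sqrtr_ge0. Qed.

Lemma cabs0 : cabs (0 : R[i]) = 0.
Proof. by apply: (@complexI R); rewrite cabsE normr0. Qed.

Lemma cabs1 : cabs (1 : R[i]) = 1.
Proof. by apply: (@complexI R); rewrite cabsE normr1. Qed.

Lemma cabsM z w : cabs (z * w) = cabs z * cabs w.
Proof. by apply: (@complexI R); rewrite rmorphM /= !cabsE normrM. Qed.

Lemma cabsX z n : cabs (z ^+ n) = cabs z ^+ n.
Proof. by apply: (@complexI R); rewrite rmorphXn /= !cabsE normrX. Qed.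

Lemma cabsN z : cabs (- z) = cabs z.
Proof. by apply: (@complexI R); rewrite !cabsE normrN. Qed.

Lemma cabsJ z : cabs (conjc z) = cabs z.
Proof. by apply: (@complexI R); rewrite !cabsE normcJ. Qed.

Lemma cabsC x : cabs (x%:C)%C = `|x|.
Proof. by rewrite /cabs /= expr0n addr0 sqrtr_sqr. Qed.

Lemma cabsR x : 0 <= x -> cabs (x%:C)%C = x.
Proof. by move=> x0; rewrite cabsC ger0_norm. Qed.

Lemma cabsD z w : cabs (z + w) <= cabs z + cabs w.
Proof. by rewrite -lecR rmorphD /= !cabsE ler_normD. Qed.

Lemma cabsB z w : cabs (z - w) <= cabs z + cabs w.
Proof. by rewrite (le_trans (cabsD _ _))// cabsN. Qed.

Lemma cabs_sum (I : Type) (s : seq I) (P : pred I) (F : I -> R[i]) :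
  cabs (\sum_(i <- s | P i) F i) <= \sum_(i <- s | P i) cabs (F i).
Proof.
elim/big_ind2 : _ => [|z x w y zx wy|//]; first by rewrite cabs0.
by rewrite (le_trans (cabsD _ _))// lerD.
Qed.

Lemma ler_Re_cabs z : `|complex.Re z| <= cabs z.
Proof. by rewrite /cabs -sqrtr_sqr ler_wsqrtr// lerDl sqr_ge0. Qed.

Lemma ler_Im_cabs z : `|complex.Im z| <= cabs z.
Proof. by rewrite /cabs -sqrtr_sqr ler_wsqrtr// lerDr sqr_ge0. Qed.

Lemma cabs_le_ReIm z : cabs z <= `|complex.Re z| + `|complex.Im z|.
Proof.
rewrite {1}[z]complexE (le_trans (cabsD _ _))// cabsM !cabsC.
suff -> : cabs 'i%C = 1 :> R by rewrite mul1r.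
by rewrite /cabs /= expr0n add0r expr1n sqrtr1.
Qed.

End ComplexModulus.

(** * Series *)

Section RealSeries.
Variable R : realType.
Implicit Types (f g : nat -> R) (u : nat -> R[i]).

Lemma squeeze0 f g : (forall n, 0 <= f n <= g n) -> g @ \oo --> (0 : R) ->
  f @ \oo --> (0 : R).
Proof. by move=> fg; apply: squeeze_cvgr (cvg_cst 0); exact: nearW. Qed.

Lemma seriesEord g N : series g N = \sum_(n < N) g n.
Proof. by rewrite /series /= big_mkord. Qed.

Lemma nondecreasing_nnseries g : (forall n, 0 <= g n) ->
  {homo series g : n m / (n <= m)%N >-> n <= m}.
Proof. by move=> g0; apply: nondecreasing_series => n _ _. Qed.

Lemma nnseries_bounded_cvg g M : (forall n, 0 <= g n) ->
  (forall N, series g N <= M) -> cvgn (series g).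
Proof.
move=> g0 gM; apply: nondecreasing_is_cvgn; first exact: nondecreasing_nnseries.
by exists M => _ [N _ <-].
Qed.

Lemma nnseries_le_lim g N : (forall n, 0 <= g n) -> cvgn (series g) ->
  series g N <= limn (series g).
Proof. by move=> g0 cg; exact: nondecreasing_cvgn_le (nondecreasing_nnseries g0) cg N. Qed.

Lemma nnseries_lim_ge0 g : (forall n, 0 <= g n) -> cvgn (series g) ->
  0 <= limn (series g).
Proof.
by move=> g0 /(nnseries_le_lim 0 g0); rewrite /series /= big_geq.
Qed.

Lemma nnseries_tail g : cvgn (series g) ->
  (fun N => limn (series g) - series g N) @ \oo --> (0 : R).
Proof.
by move=> cg; rewrite -(subrr (limn (series g))); apply: cvgB => //; exact: cvg_cst.
Qed.

Lemma nneseriesE g : (forall n, 0 <= g n) -> cvgn (series g) ->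
  (\sum_(0 <= n <oo) (g n)%:E)%E = (limn (series g))%:E.
Proof.
move=> g0 cg; rewrite -EFin_lim//; congr (limn _).
by apply/funext => N /=; rewrite /series /= sumEFin.
Qed.

Lemma nneseries_ltoo g : (forall n, 0 <= g n) ->
  ((\sum_(0 <= n <oo) (g n)%:E)%E < +oo)%E <-> cvgn (series g).
Proof.
move=> g0; split=> [|cg]; first exact: nnseries_is_cvg.
by rewrite nneseriesE// ltry.
Qed.

Lemma cvg_seriesM c g : cvgn (series g) -> cvgn (series (fun n => c * g n)).
Proof. exact: is_cvg_seriesZ. Qed.

Lemma lim_seriesM c g : cvgn (series g) ->
  limn (series (fun n => c * g n)) = c * limn (series g).
Proof. exact: lim_seriesZ. Qed.

(** The quadratic t -> sum (x_i - y_i t)^2 is nonnegative; its value at its minimum S/Y gives the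
    inequality. *)
Lemma cauchy_schwarz_sum (I : Type) (s : seq I) (x y : I -> R) :
  (\sum_(i <- s) x i * y i) ^+ 2 <=
  (\sum_(i <- s) x i ^+ 2) * (\sum_(i <- s) y i ^+ 2).
Proof.
set X := \sum_(i <- s) x i ^+ 2; set Y := \sum_(i <- s) y i ^+ 2.
set S := \sum_(i <- s) _.
have q (t : R) : 0 <= X - S * t *+ 2 + Y * t ^+ 2.
  have -> : X - S * t *+ 2 + Y * t ^+ 2 = \sum_(i <- s) (x i - y i * t) ^+ 2.
    rewrite [RHS](_ : _ = \sum_(i <- s) (x i ^+ 2 - x i * y i * t *+ 2 + y i ^+ 2 * t ^+ 2)).
      by rewrite big_split sumrB sumrMnl -!mulr_suml.
    by apply: eq_bigr => i _; ring.
  by apply: sumr_ge0 => i _; exact: sqr_ge0.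
have Y0 : 0 <= Y by apply: sumr_ge0 => i _; exact: sqr_ge0.
have [Y00|Yn0] := eqVneq Y 0; last first.
  have /(mulr_ge0 Y0) := q (S / Y).
  have -> : Y * (X - S * (S / Y) *+ 2 + Y * (S / Y) ^+ 2) = X * Y - S ^+ 2.
    by field.
  by rewrite subr_ge0.
(* With Y = 0 the quadratic is affine in t; at t = (X + 1)/S it would equal -X - 2 < 0. *)
have S0 : S = 0.
  apply/eqP; apply: contraT => Sn0.
  have := q ((X + 1) / S); rewrite Y00 mul0r addr0.
  have -> : S * ((X + 1) / S) = X + 1 by field.
  have : 0 <= X by apply: sumr_ge0 => i _; exact: sqr_ge0.
  by move=> ? ?; lra.
by rewrite S0 expr0n /= Y00 mulr0.
Qed.

End RealSeries.

Section ComplexSequences.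
Variable R : realType.
Implicit Types (u v : nat -> R[i]) (g : nat -> R).

Lemma ccvg_ReIm u (l : R[i]) : ccvg_to u l <->
  (fun n => complex.Re (u n)) @ \oo --> complex.Re l /\
  (fun n => complex.Im (u n)) @ \oo --> complex.Im l.
Proof.
have dist0 (f : nat -> R) (c : R) :
    (fun n => `|f n - c|) @ \oo --> (0 : R) <-> f @ \oo --> c.
  by split=> /cvgrPdist_le h; apply/cvgrPdist_le => e /h; apply: filterS => n;
    rewrite sub0r normrN normr_id distrC.
have ReB z w : complex.Re (z - w) = complex.Re z - complex.Re w :> R.
  by case: z w => [? ?] [? ?].
have ImB z w : complex.Im (z - w) = complex.Im z - complex.Im w :> R.
  by case: z w => [? ?] [? ?].
split=> [ul|[/dist0 ReP /dist0 ImP]].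
- by split; apply/dist0; refine (squeeze0 _ ul) => n;
    rewrite normr_ge0 -?ReB -?ImB ?ler_Re_cabs ?ler_Im_cabs.
- have H : (fun n => `|complex.Re (u n) - complex.Re l|
      + `|complex.Im (u n) - complex.Im l|) @ \oo --> (0 + 0 : R).
    exact: cvgD.
  rewrite addr0 in H; refine (squeeze0 _ H) => n.
  by rewrite cabs_ge0 (le_trans (cabs_le_ReIm _))// ReB ImB.
Qed.

Lemma ccvg_clim u (l : R[i]) : ccvg_to u l -> clim u = l.
Proof.
move=> /ccvg_ReIm[Rel Iml]; rewrite /clim (cvg_lim _ Rel)// (cvg_lim _ Iml)//.
by case: l {Rel Iml}.
Qed.

Lemma cseries_csum u (l : R[i]) : cseries_to u l -> csum u = l.
Proof. exact: ccvg_clim. Qed.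

Lemma ccvg_dist_le u (l c : R[i]) (M : R) : ccvg_to u l ->
  (\forall n \near \oo, cabs (u n - c) <= M) -> cabs (l - c) <= M.
Proof.
move=> ul uM; have : (fun n => cabs (u n - l) + M) @ \oo --> (0 + M).
  by apply: cvgD ul _; exact: cvg_cst.
rewrite add0r => cM; rewrite -(cvg_lim _ cM)//; apply: limr_ge.
  by apply/cvg_ex; exists M.
near=> n; rewrite (_ : l - c = (u n - c) - (u n - l)); last by ring.
by rewrite (le_trans (cabsB _ _))// addrC lerD2l; near: n.
Unshelve. all: end_near. Qed.

Lemma ccvg_le u (l : R[i]) (M : R) : ccvg_to u l ->
  (forall n, cabs (u n) <= M) -> cabs l <= M.
Proof.
move=> ul uM; rewrite -[l]subr0; apply: ccvg_dist_le ul _.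
by apply: nearW => n; rewrite subr0.
Qed.

Lemma ccvgD_scale u v (l m c : R[i]) : ccvg_to u l -> ccvg_to v m ->
  ccvg_to (fun n => u n + c * v n) (l + c * m).
Proof.
move=> ul vm; have : (fun n => cabs (u n - l) + cabs c * cabs (v n - m)) @ \oo
    --> (0 + cabs c * 0) by apply: cvgD ul _; exact: cvgMl_tmp.
rewrite mulr0 addr0 => H; refine (squeeze0 _ H) => n; rewrite cabs_ge0 /= -cabsM.
rewrite (_ : _ - _ = (u n - l) + c * (v n - m)); last by ring.
exact: cabsD.
Qed.

Lemma cseriesD_scale u v (l m c : R[i]) : cseries_to u l -> cseries_to v m ->
  cseries_to (fun n => u n + c * v n) (l + c * m).
Proof.
move=> ul vm; rewrite /cseries_to; under [X in ccvg_to X _]funext => N.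
  by rewrite big_split -mulr_sumr; over.
exact: ccvgD_scale.
Qed.

Lemma cseries_dominated u g : (forall n, cabs (u n) <= g n) ->
  cvgn (series g) -> cseries_to u (csum u).
Proof.
move=> ug cg.
(* [p] is the real or the imaginary part: [csum] is defined componentwise, and each component is an
   absolutely convergent real series. *)
have part (p : R[i] -> R) : (forall z, `|p z| <= cabs z) ->
    {morph p : z w / z + w} -> p 0 = 0 ->
    cvgn (fun N => p (\sum_(n < N) u n)).
  move=> ple pD p0.
  have -> : (fun N => p (\sum_(n < N) u n)) = series (p \o u).
    by apply/funext => N; rewrite seriesEord (big_morph p pD p0).
  apply: normed_cvg; apply: series_le_cvg cg => n //=.
  - exact: le_trans (cabs_ge0 _) (ug n).
  - exact: le_trans (ple _) (ug n).
apply/ccvg_ReIm; split; apply: part => //.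
- exact: ler_Re_cabs.
- by case=> [? ?] [? ?].
- exact: ler_Im_cabs.
- by case=> [? ?] [? ?].
Qed.

Lemma csum_tail u g N : (forall n, cabs (u n) <= g n) -> cvgn (series g) ->
  cabs (csum u - \sum_(n < N) u n) <= limn (series g) - series g N.
Proof.
move=> ug cg; have g0 n : 0 <= g n := le_trans (cabs_ge0 _) (ug n).
apply: (ccvg_dist_le (cseries_dominated ug cg)).
exists N => // m /= Nm.
apply: (@le_trans _ _ (series g m - series g N)); last first.
  by rewrite lerD2r; exact: nnseries_le_lim.
rewrite !seriesEord -!(big_mkord xpredT) (big_cat_nat (leq0n N) Nm)//= [X in X - _]addrC addrK.
rewrite (big_cat_nat (leq0n N) Nm)//= [X in _ <= X - _]addrC addrK.
by rewrite (le_trans (cabs_sum _ _ _))// ler_sum.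
Qed.

Lemma csum_le u g : (forall n, cabs (u n) <= g n) -> cvgn (series g) ->
  cabs (csum u) <= limn (series g).
Proof.
move=> ug cg; have := csum_tail 0 ug cg.
by rewrite big_ord0 subr0 seriesEord big_ord0 subr0.
Qed.

End ComplexSequences.

(** * Power decay *)

Section PowerDecay.
Variable R : realType.
Implicit Types (p q e : R) (n k : nat).

Definition decay p n : R := n.+1%:R `^ (- p).

Lemma decay_gt0 p n : 0 < decay p n.
Proof. by rewrite powR_gt0. Qed.

Lemma decay_ge0 p n : 0 <= decay p n. Proof. exact/ltW/decay_gt0. Qed.

Lemma decayD p q n : decay (p + q) n = decay p n * decay q n.
Proof. by rewrite /decay opprD powRD// pnatr_eq0 implybT. Qed.

Lemma decay1 n : decay 1 n = n.+1%:R^-1.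
Proof. by rewrite /decay powR_inv1. Qed.

Lemma decay_le_index p n k : 0 <= p -> (n <= k)%N -> decay p k <= decay p n.
Proof.
move=> p0 nk; rewrite /decay !powRN lef_pV2 ?posrE ?powR_gt0//.
by apply: ge0_ler_powR => //; rewrite ?nnegrE// ler_nat.
Qed.

(** Both n + 1 and k + 1 are at most n + k + 1. This replaces the Hankel kernel by a function of k
    times a function of n. *)
Lemma decay_split p q n k : 0 <= p -> 0 <= q ->
  decay (p + q) (n + k) <= decay p k * decay q n.
Proof.
move=> p0 q0; rewrite decayD ler_pM ?decay_ge0// decay_le_index//.
- exact: leq_addl.
- exact: leq_addr.
Qed.

Lemma decay_sqr p n : decay p n ^+ 2 = decay (p + p) n.
Proof. by rewrite decayD. Qed.

(* [(1 + 1/(n+1))^e >= 1 + e ln (1 + 1/(n+1)) >= 1 + e/(n+2)]. *)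
Lemma decay_telescope e n : 0 <= e ->
  e * decay (e + 1) n.+1 <= decay e n - decay e n.+1.
Proof.
move=> e0; rewrite decayD decay1 lerBrDr.
have -> : decay e n = decay e n.+1 * (n.+2%:R / n.+1%:R) `^ e.
  rewrite powRM// -[_^-1]powR_inv1// -powRrM mulN1r /decay.
  rewrite [n.+2%:R `^ (- e)]powRN mulrA mulVf ?mul1r//.
rewrite mulrCA -{2}[decay e n.+1]mulr1 -mulrDr ler_pM2l ?decay_gt0//.
rewrite /powR mulf_eq0 invr_eq0 !pnatr_eq0 /=.
rewrite (le_trans _ (expR_ge1Dx _))// addrC lerD2l ler_wpM2l//.
rewrite -[_ / _]invrK lnV ?posrE ?invr_gt0 ?divr_gt0// lerNr.
rewrite invf_div (_ : n.+1%:R / n.+2%:R = 1 + - n.+2%:R^-1); last first.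
  by apply: (mulIf (_ : n.+2%:R != 0 :> R)); rewrite ?pnatr_eq0// mulfVK ?pnatr_eq0//
    mulrDl mul1r mulNr mulVf ?pnatr_eq0// -(natrB _ (_ : 1 <= n.+2)%N)// subn1.
by rewrite le_ln1Dx// ltrN2 invf_lt1// ltr1n.
Qed.

Lemma cvg_decay p : 1 < p -> cvgn (series (decay p)).
Proof.
move=> p1; have e0 : 0 < p - 1 by rewrite subr_gt0.
apply: (@nnseries_bounded_cvg _ _ (1 + (p - 1)^-1)) => [n|N]; first exact: decay_ge0.
(* Strengthened for induction: 1 is the term of index 0, and the terms of index 1 to N telescope by
   [decay_telescope] at exponent p - 1. *)
suff : series (decay p) N.+1 <= 1 + (p - 1)^-1 * (1 - decay (p - 1) N).
  move=> H; apply: (@le_trans _ _ (series (decay p) N.+1)).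
    by apply: nondecreasing_nnseries => // n; exact: decay_ge0.
  rewrite (le_trans H)// lerD2l ler_piMr ?invr_ge0 ?(ltW e0)//.
  by rewrite gerBl decay_ge0.
elim: N => [|N IH].
  by rewrite seriesEord big_ord1 /decay !powR1 subrr mulr0 addr0.
rewrite seriesEord big_ord_recr -seriesEord (le_trans (lerD IH (lexx _)))//=.
rewrite -addrA lerD2l addrC -lerBrDr -mulrBr.
rewrite [X in _^-1 * X](_ : _ = decay (p - 1) N - decay (p - 1) N.+1); last by ring.
rewrite mulrC ler_pdivlMr// mulrC.
by have := @decay_telescope (p - 1) N (ltW e0); rewrite subrK.
Qed.

End PowerDecay.

(** * Nuclear operators into the Wiener algebra *)

Section ComplexSpaces.
Variable R : realType.
Implicit Types (a b : nat -> R[i]) (u v w : nat -> R).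

Lemma l1eE a : cvgn (series (fun n => cabs (a n))) ->
  l1e a = (limn (series (fun n => cabs (a n))))%:E.
Proof. by move=> ca; rewrite /l1e nneseriesE// => n; exact: cabs_ge0. Qed.

Lemma ATP a : AT a <-> cvgn (series (fun n => cabs (a n))).
Proof. by apply: nneseries_ltoo => n; exact: cabs_ge0. Qed.

Lemma AT_normE a : AT a -> AT_norm a = limn (series (fun n => cabs (a n))).
Proof. by move=> /ATP ca; rewrite /AT_norm l1eE. Qed.

Lemma AT_dominated a w : (forall n, cabs (a n) <= w n) ->
  cvgn (series w) -> AT a.
Proof.
move=> aw cw; apply/ATP; apply: series_le_cvg cw => // n; first exact: cabs_ge0.
exact: le_trans (cabs_ge0 _) (aw n).
Qed.

Lemma H2P a : H2 a <-> cvgn (series (fun n => cabs (a n) ^+ 2)).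
Proof. by apply: nneseries_ltoo => n; exact: sqr_ge0. Qed.

Lemma H2_normE a : H2 a ->
  H2_norm a = Num.sqrt (limn (series (fun n => cabs (a n) ^+ 2))).
Proof.
by move=> /H2P ca; rewrite /H2_norm /l2sq nneseriesE// => n; exact: sqr_ge0.
Qed.

Lemma H2_norm_ge0 a : 0 <= H2_norm a. Proof. exact: sqrtr_ge0. Qed.

Lemma H2_normK a : H2 a ->
  H2_norm a ^+ 2 = limn (series (fun n => cabs (a n) ^+ 2)).
Proof.
move=> Ha; rewrite H2_normE// sqr_sqrtr//.
by apply: nnseries_lim_ge0 => [n|]; [exact: sqr_ge0|exact/H2P].
Qed.

Lemma H2_dominated a w : (forall n, cabs (a n) <= w n) ->
  cvgn (series (fun n => w n ^+ 2)) -> H2 a.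
Proof.
move=> aw cw; apply/H2P; apply: series_le_cvg cw => n; rewrite ?sqr_ge0//.
by rewrite ler_pXn2r// nnegrE ?cabs_ge0// (le_trans _ (aw n))// cabs_ge0.
Qed.

Lemma H2_pairing_le v a N : (forall n, 0 <= v n) ->
  cvgn (series (fun n => v n ^+ 2)) -> H2 a ->
  series (fun n => v n * cabs (a n)) N <=
  Num.sqrt (limn (series (fun n => v n ^+ 2))) * H2_norm a.
Proof.
move=> v0 cv Ha; rewrite H2_normE// -sqrtrM; last first.
  by apply: nnseries_lim_ge0 => // n; exact: sqr_ge0.
rewrite -[leLHS]ger0_norm; last first.
  by apply: sumr_ge0 => n _; rewrite mulr_ge0 ?cabs_ge0.
rewrite -sqrtr_sqr ler_wsqrtr// (le_trans (cauchy_schwarz_sum _ _ _))//.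
apply: ler_pM; try by apply: sumr_ge0 => i _; exact: sqr_ge0.
- by apply: (nnseries_le_lim (g := fun n => v n ^+ 2)) => // n; exact: sqr_ge0.
- apply: (nnseries_le_lim (g := fun n => cabs (a n) ^+ 2)) => [n|]; last exact/H2P.
  exact: sqr_ge0.
Qed.

Lemma H2_pairing_cvg v a : (forall n, 0 <= v n) ->
  cvgn (series (fun n => v n ^+ 2)) -> H2 a ->
  cvgn (series (fun n => v n * cabs (a n))).
Proof.
move=> v0 cv Ha; apply: (nnseries_bounded_cvg _ (fun N => H2_pairing_le N v0 cv Ha)) => n.
by rewrite mulr_ge0 ?cabs_ge0.
Qed.

Lemma H2_pairing_lim_le v a : (forall n, 0 <= v n) ->
  cvgn (series (fun n => v n ^+ 2)) -> H2 a ->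
  limn (series (fun n => v n * cabs (a n))) <=
  Num.sqrt (limn (series (fun n => v n ^+ 2))) * H2_norm a.
Proof.
move=> v0 cv Ha; apply: limr_le; first exact: H2_pairing_cvg.
by apply: nearW => N; exact: H2_pairing_le.
Qed.

(** Each coordinate vector has norm at most 1 in the Wiener algebra, so the nuclear sum is dominated
    by the series of [c]. [X] and [normX] stay abstract to serve both H^infty and H^2. *)
Lemma nuclear_coordinates (X : (nat -> R[i]) -> Prop) (normX : (nat -> R[i]) -> R)
    (T : (nat -> R[i]) -> nat -> R[i]) (c : nat -> R) :
  (forall a b (lam : R[i]) k, X a -> X b ->
    T (fun n => a n + lam * b n) k = T a k + lam * T b k) ->
  (forall k, 0 <= c k) -> cvgn (series c) ->
  (forall a k, X a -> cabs (T a k) <= c k * normX a) ->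
  maps_into X (@AT R) T /\ nuclear X normX (@AT R) (@AT_norm R) T.
Proof.
move=> Tlin c0 cc Tle.
have XT a : X a -> AT (T a).
  move=> Xa; apply: (@AT_dominated _ (fun k => normX a * c k)) => [n|].
    by rewrite mulrC Tle.
  exact: cvg_seriesM.
pose y (n k : nat) : R[i] := (n == k)%:R.
have y_sum n N : series (fun k => cabs (y n k)) N <= 1.
  rewrite seriesEord; have [nN|Nn] := ltnP n N.
    rewrite (bigD1 (Ordinal nN))//= /y eqxx cabs1 big1 ?addr0// => i /negPf ni.
    by rewrite -val_eqE /= eq_sym in ni; rewrite ni cabs0.
  by rewrite big1// => i _; rewrite /y gtn_eqF ?cabs0// (leq_trans (ltn_ord i)).
have y_cvg n : cvgn (series (fun k => cabs (y n k))).
  by apply: nnseries_bounded_cvg (y_sum n) => k; exact: cabs_ge0.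
have yAT n : AT (y n) by apply/ATP.
split=> //; exists (fun n a => T a n), c, y; split=> [n a b lam|]; first exact: Tlin.
split; [exact: c0|split; [by move=> n a /Tle|split; [exact: yAT|split]]].
  have cy n : 0 <= c n * AT_norm (y n) <= c n.
    rewrite AT_normE//; apply/andP; split.
      by rewrite mulr_ge0// nnseries_lim_ge0// => k; exact: cabs_ge0.
    rewrite ler_piMr//; apply: limr_le => //; exact: nearW.
  apply/nneseries_ltoo => [n|]; first by have /andP[] := cy n.
  by apply: series_le_cvg cc => // n; have /andP[] := cy n.
move=> a Xa; have /ATP ca := XT _ Xa; have := nnseries_tail ca.
set g := fun n => cabs (T a n) in ca *.
apply: cvg_trans; apply: near_eq_cvg; apply: nearW => N /=.
(* Subtracting the first N rank-one terms sets the first N coordinates to 0, so the norm of the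
   remainder is a tail of the series of |(T a)_k|. *)
rewrite (_ : (fun k => _) = (fun k => if (k < N)%N then 0 else T a k)); last first.
  apply/funext => k; rewrite /y; case: ltnP => kN.
    rewrite (bigD1 (Ordinal kN))//= eqxx mulr1 big1 ?addr0 ?subrr// => i /negPf ni.
    by rewrite -val_eqE /= in ni; rewrite ni mulr0.
  rewrite big1 ?subr0// => i _.
  by rewrite ltn_eqF ?mulr0// (leq_trans (ltn_ord i)).
have tail_sum M : series (fun k => cabs (if (k < N)%N then 0 else T a k)) M
    = series g M - series g (minn N M).
  elim: M => [|M IH]; first by rewrite minn0 /series /= !big_geq ?subrr.
  have seriesS (h : nat -> R) : series h M.+1 = series h M + h M.
    by rewrite !seriesEord big_ord_recr.
  rewrite seriesS IH; case: ltnP => MN.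
    by rewrite (minn_idPr MN) cabs0 !subrr addr0.
  by rewrite (minn_idPl (leqW MN)) seriesS addrAC.
have tail_cvg : series (fun k => cabs (if (k < N)%N then 0 else T a k)) @ \oo
    --> limn (series g) - series g N.
  have : (fun M => series g M - series g N) @ \oo --> limn (series g) - series g N.
    by apply: cvgB => //; exact: cvg_cst.
  apply: cvg_trans; apply: near_eq_cvg; exists N => // M /= NM.
  by rewrite tail_sum (minn_idPl NM).
rewrite AT_normE; last by apply/ATP; apply/cvg_ex; eexists; exact: tail_cvg.
by rewrite (cvg_lim _ tail_cvg).
Qed.

End ComplexSpaces.

(** * Landau's coefficients and roots of unity *)

Section Landau.
Variable R : realType.

(* Taylor coefficients of (1 - z)^(-1/2). *)
Fixpoint landau (n : nat) : R :=
  if n is m.+1 then landau m * (1 - (n.*2)%:R^-1) else 1.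

Lemma landau_ge0 n : 0 <= landau n.
Proof.
elim: n => //= n IH; rewrite mulr_ge0// subr_ge0 invf_le1 ?ltr0n//.
by rewrite ler1n.
Qed.

Lemma landauS n : n.+1%:R * landau n.+1 *+ 2 = landau n * n.*2.+1%:R.
Proof.
have n0 : n.+1%:R != 0 :> R by rewrite pnatr_eq0.
have -> : landau n.+1 = landau n * (1 - (n.+1%:R *+ 2)^-1) by rewrite -mulrnA muln2.
have -> : n.*2.+1%:R = n.+1%:R *+ 2 - 1 :> R.
  by rewrite -mulrnA muln2 doubleS -[n.*2.+2]addn1 natrD addrK.
by field.
Qed.

(** Writing c_n for [landau n], c_n^2 (2n+1) is nonincreasing from the value 1, because (2n+1)(2n+3)
    <= (2n+2)^2. *)
Lemma landau_sqr_le n : landau n ^+ 2 <= n.+1%:R^-1.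
Proof.
suff H : landau n ^+ 2 * n.*2.+1%:R <= 1.
  rewrite -[leRHS]mul1r ler_pdivlMr ?ltr0n// (le_trans _ H)//.
  by rewrite ler_wpM2l ?sqr_ge0// ler_nat ltnS -addnn leq_addr.
elim: n => [|n IH]; first by rewrite expr1n mul1r.
apply: le_trans IH; have n0 : 0 < n.+1%:R :> R by rewrite ltr0n.
have -> : landau n.+1 = landau n * n.*2.+1%:R / n.+1.*2%:R.
  by rewrite -landauS -[n.+1.*2]mul2n natrM; field; rewrite gt_eqF.
rewrite -subr_ge0.
have -> : landau n ^+ 2 * n.*2.+1%:R - (landau n * n.*2.+1%:R / n.+1.*2%:R) ^+ 2
    * n.+1.*2.+1%:R = landau n ^+ 2 * n.*2.+1%:R / (n.+1.*2%:R) ^+ 2 :> R.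
  have -> : n.*2.+1%:R = n.+1.*2%:R - 1 :> R.
    by rewrite doubleS -[n.*2.+2]addn1 natrD addrK.
  have -> : n.+1.*2.+1%:R = n.+1.*2%:R + 1 :> R by rewrite -addn1 natrD.
  by field; rewrite pnatr_eq0.
apply: divr_ge0; last exact: sqr_ge0.
by apply: mulr_ge0; [exact: sqr_ge0|exact: ler0n].
Qed.

(* Both sides count: [sum_i (i + (n+1-i)) c_i c_(n+1-i)], once by symmetry and
   once through the recurrence [2 (i+1) c_(i+1) = (2i+1) c_i]. *)
Lemma landau_convolution n : \sum_(i < n.+1) landau i * landau (n - i) = 1.
Proof.
elim: n => [|n IH]; first by rewrite big_ord1 /= mulr1.
set S := \sum_(i < n.+2) _.
have weight m (x y : nat -> R) : \sum_(i < m.+1) (m - i)%:R * (x i * y (m - i)%N)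
    = \sum_(i < m.+1) i%:R * (y i * x (m - i)%N).
  rewrite (reindex_inj rev_ord_inj) /=; apply: eq_bigr => i _.
  by rewrite subSS subKn ?[x _ * _]mulrC// -ltnS.
have twice m : (\sum_(i < m.+1) i%:R * (landau i * landau (m - i))) *+ 2
    = m%:R * \sum_(i < m.+1) landau i * landau (m - i).
  rewrite mulr2n -{1}weight -big_split mulr_sumr; apply: eq_bigr => i _ /=.
  by rewrite -mulrDl -natrD subnK// -ltnS.
have : n.+1%:R * S = n.+1%:R.
  rewrite -twice big_ord_recl mul0r add0r -sumrMnl.
  (* After the index shift, 2(i+1) c_(i+1) = (2i+1) c_i splits each term into a part with weight 2i
     and a part with weight 1. *)
  transitivity ((\sum_(i < n.+1) i%:R * (landau i * landau (n - i))) *+ 2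
      + \sum_(i < n.+1) landau i * landau (n - i)).
    rewrite -sumrMnl -big_split; apply: eq_bigr => i _.
    rewrite lift0 subSS mulrA -mulrnAl landauS -[i.*2.+1]addn1 -mul2n natrD natrM /=.
    by ring.
  by rewrite twice IH mulr1 -natr1.
by rewrite -[RHS]mulr1 => /mulfI; apply; rewrite pnatr_eq0.
Qed.

End Landau.

Section RootsOfUnity.
Variable C : numClosedFieldType.

(** X^n - 1 splits and is separable in characteristic 0, so it has n distinct roots, and n distinct
    n-th roots of unity include a primitive one. *)
Lemma ex_prim_root n : (0 < n)%N -> exists z : C, n.-primitive_root z.
Proof.
move=> n_gt0; pose p : {poly C} := 'X^n - 1.
have [r Dp] := closed_field_poly_normal p.
rewrite (monicP _) ?monicXnsubC// scale1r in Dp.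
have rn1 : all n.-unity_root r by apply/allP => z; rewrite -root_prod_XsubC -Dp.
have sz_r : (n < (size r).+1)%N by rewrite -(size_prod_XsubC r id) -Dp size_XnsubC.
have [|z] := hasP (cyclic.has_prim_root n_gt0 rn1 _ sz_r); last by exists z.
by rewrite -separable_prod_XsubC -Dp separable_Xn_sub_1// pnatr_eq0 -lt0n.
Qed.

Lemma sum_prim_root n (z : C) k : n.-primitive_root z -> ~~ (n %| k)%N ->
  \sum_(j < n) (z ^+ j) ^+ k = 0.
Proof.
move=> zP nk; under eq_bigr do rewrite -exprM mulnC exprM.
have /eqP : (z ^+ k - 1) * \sum_(j < n) (z ^+ k) ^+ j = 0.
  by rewrite -subrX1 -exprM mulnC exprM (prim_expr_order zP) expr1n subrr.
by rewrite mulf_eq0 subr_eq0 -(prim_order_dvd zP) (negPf nk) => /eqP.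
Qed.

Lemma norm_prim_root n (z : C) : n.-primitive_root z -> `|z| = 1.
Proof.
move=> zP; apply/eqP; rewrite -(pexpr_eq1 (prim_order_gt0 zP))//.
by rewrite -normrX (prim_expr_order zP) normr1.
Qed.

End RootsOfUnity.

(** * Circle means of polynomials as averages over roots of unity *)

Section PolynomialCoefficients.
Variable C : numClosedFieldType.
Implicit Types (F p q : {poly C}) (s M z : C).

(** The number i + (L - k) lies strictly between 0 and 2L, so L is the only multiple of L that it
    can equal. *)
Lemma dvdn_shift_sub L i k : (i < L)%N -> (k < L)%N ->
  (L %| i + (L - k))%N = (i == k).
Proof.
move=> iL kL; apply/idP/eqP => [|->]; last by rewrite subnKC// ltnW.
move=> /dvdnP[[|[|m]]]; rewrite ?mul0n ?mul1n ?mulSn; lia.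
Qed.

(** Discrete Fourier inversion: on L-th roots of unity the exponent [L - k] acts as -k, and
    orthogonality keeps only the index i = k. *)
Lemma sum_roots_coef L z (c : nat -> C) k : L.-primitive_root z -> (k < L)%N ->
  \sum_(j < L) (\sum_(i < L) c i * (z ^+ j) ^+ i) * (z ^+ j) ^+ (L - k)
  = L%:R * c k.
Proof.
move=> zP kL; under eq_bigr do rewrite mulr_suml.
rewrite exchange_big (bigD1 (Ordinal kL))//= [X in _ + X]big1 => [|i /negPf ik].
  rewrite addr0 mulr_natl -[in RHS](card_ord L) -sumr_const.
  apply: eq_bigr => j _; rewrite -mulrA -exprD subnKC ?(ltnW kL)//.
  by rewrite exprAC (prim_expr_order zP) expr1n mulr1.
under eq_bigr do rewrite -mulrA -exprD.
by rewrite -mulr_sumr (sum_prim_root zP) ?mulr0// dvdn_shift_sub//;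
  move: ik; rewrite -val_eqE /= => ->.
Qed.

Lemma horner_scaled q L s z : (size q <= L)%N ->
  q.[s * z] = \sum_(i < L) (q`_i * s ^+ i) * z ^+ i.
Proof.
move=> qL; rewrite (horner_coef_wide _ qL).
by apply: eq_bigr => i _; rewrite exprMn mulrA.
Qed.

Lemma parseval_roots L z p s : L.-primitive_root z -> (size p <= L)%N -> 0 <= s ->
  \sum_(j < L) `|p.[s * z ^+ j]| ^+ 2
  = L%:R * \sum_(i < L) `|p`_i| ^+ 2 * s ^+ (i + i).
Proof.
move=> zP pL s0; have L0 := prim_order_gt0 zP.
(* On the unit circle conjugation is inversion, here written as the power [L - l]; this brings the
   squared modulus to the form that [sum_roots_coef] evaluates. *)
have zconj j l : (l < L)%N -> ((z ^+ j) ^+ l)^* = (z ^+ j) ^+ (L - l).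
  move=> lL; have z1 : `|(z ^+ j) ^+ l| = 1.
    by rewrite !normrX (norm_prim_root zP) !expr1n.
  have zz : (z ^+ j) ^+ l * (z ^+ j) ^+ (L - l) = 1.
    by rewrite -exprD subnKC ?(ltnW lL)// exprAC (prim_expr_order zP) expr1n.
  apply: (@mulfI _ ((z ^+ j) ^+ l)); first by rewrite -normr_eq0 z1 oner_eq0.
  by rewrite zz -normCK z1 expr1n.
transitivity (\sum_(j < L) \sum_(l < L) (p`_l * s ^+ l)^* *
    ((\sum_(i < L) (p`_i * s ^+ i) * (z ^+ j) ^+ i) * (z ^+ j) ^+ (L - l))).
  apply: eq_bigr => j _; rewrite normCK (horner_scaled _ _ pL) [X in _ * X]rmorph_sum.
  rewrite mulr_sumr; apply: eq_bigr => l _.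
  rewrite [X in _ * X = _](_ : _ = (p`_l * s ^+ l)^* * (z ^+ j) ^+ (L - l));
    last by rewrite -zconj// -rmorphM.
  by rewrite mulrCA.
rewrite exchange_big mulr_sumr; apply: eq_bigr => l _ /=.
rewrite -mulr_sumr (sum_roots_coef (fun i => p`_i * s ^+ i))// rmorphM rmorphXn /=.
by rewrite (CrealP (ger0_real s0)) normCK exprD; ring.
Qed.

(* Averaging over the [L]-th roots of unity is the circle mean for polynomials of
   degree less than [L]. *)
Lemma coef_mul_sqr_le F p s M k : 0 <= s ->
  (forall w, `|w| = s -> `|F.[w]| <= M) ->
  `|(F * (p * p))`_k| * s ^+ k
  <= M * \sum_(i < size p) `|p`_i| ^+ 2 * s ^+ (i + i).
Proof.
move=> s0 FM; set Q := F * (p * p).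
(* L exceeds k and the sizes of F p^2 and p, so averaging over the L-th roots causes no aliasing. *)
pose L := (size Q + size p + k).+1.
have [z zP] : exists z : C, L.-primitive_root z by exact: ex_prim_root.
have QL : (size Q <= L)%N by rewrite /L; lia.
have pL : (size p <= L)%N by rewrite /L; lia.
have kL : (k < L)%N by rewrite /L; lia.
have L0 : 0 < L%:R :> C by rewrite ltr0n.
have zn j : `|s * z ^+ j| = s.
  by rewrite normrM normrX (norm_prim_root zP) expr1n mulr1 ger0_norm.
rewrite -(ler_pM2l L0).
have -> : L%:R * (`|Q`_k| * s ^+ k) = `|L%:R * (Q`_k * s ^+ k)|.
  by rewrite !normrM normrX (ger0_norm s0) normr_nat.
rewrite -(sum_roots_coef (fun i => Q`_i * s ^+ i) zP kL).
(* On the circle |F p^2| <= M |p|^2: the square of p is what produces a mean of |p|^2, which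
   Parseval's identity evaluates. *)
apply: (@le_trans _ _ (\sum_(j < L) M * `|p.[s * z ^+ j]| ^+ 2)).
  apply: le_trans (ler_norm_sum _ _ _) _; apply: ler_sum => j _.
  rewrite -(horner_scaled _ _ QL) normrM !normrX (norm_prim_root zP) !expr1n mulr1.
  by rewrite /Q !hornerM !normrM -expr2 ler_wpM2r ?sqr_ge0 ?exprn_ge0// FM.
rewrite -mulr_sumr (parseval_roots zP pL s0) mulrCA.
have M0 : 0 <= M by rewrite (le_trans _ (FM _ (zn 0%N))).
rewrite ler_wpM2l// ?ler0n// ler_wpM2l//.
rewrite -(big_mkord xpredT (fun i => `|p`_i| ^+ 2 * s ^+ (i + i))) (big_cat_nat _ pL)//=.
rewrite big_mkord [X in _ + X]big_nat_cond [X in _ + X]big1 ?addr0// => i.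
by move=> /andP[/andP[pi _] _]; rewrite nth_default// normr0 expr0n mul0r.
Qed.

End PolynomialCoefficients.

(** * Coefficients of bounded holomorphic functions *)

Section BoundedHolomorphic.
Variable R : realType.
Implicit Types (a : nat -> R[i]) (s : R).

(** The bound in [Hinf] makes the supremum finite, so [fine] keeps its value instead of returning
    the default 0. *)
Lemma Hinf_norm_ge a (z l : R[i]) : Hinf a -> disc z ->
  cseries_to (fun n => a n * z ^+ n) l -> cabs l <= Hinf_norm a.
Proof.
move=> [_ [K HK]] dz zl; rewrite /Hinf_norm; set S := (X in ereal_sup X).
have Sl : S (cabs l)%:E by exists l => //; exists z.
have lS : ((cabs l)%:E <= ereal_sup S)%E by exact: ereal_sup_ubound.
have SK : (ereal_sup S <= K%:E)%E.
  by apply: ge_ereal_sup => _ [m [w dw wm] <-]; rewrite lee_fin (HK w).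
rewrite -lee_fin fineK// fin_numE.
by rewrite -ltNye (lt_le_trans (ltNyr _) lS) -ltey (le_lt_trans SK (ltry _)).
Qed.

Lemma cseries_terms_bounded (u : nat -> R[i]) : cseries_cvg u ->
  exists B, forall n, cabs (u n) <= B.
Proof.
move=> [l ul]; pose S N := \sum_(n < N) u n.
have cS : cvgn (fun N => cabs (S N - l)) by apply/cvg_ex; exists 0.
have [B [_ HB]] := cvg_seq_bounded cS.
exists ((B + 1) *+ 2) => n.
have SB N : cabs (S N - l) <= B + 1.
  by rewrite (le_trans _ (HB (B + 1) _ N I)) ?ltrDl// ler_norm.
have -> : u n = (S n.+1 - l) - (S n - l) by rewrite /S big_ord_recr /=; ring.
by rewrite (le_trans (cabsB _ _))// mulr2n lerD.
Qed.

(** Abel's lemma: the terms are bounded at an intermediate radius t, which leaves a geometric series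
    of ratio s/t. *)
Lemma Hinf_abs_cvg a s : Hinf a -> 0 <= s < 1 ->
  cvgn (series (fun n => cabs (a n) * s ^+ n)).
Proof.
move=> [Ha _] /andP[s0 s1].
have [t st t1] : exists2 t, s < t & t < 1 by exists ((1 + s) / 2%:R); lra.
have t0 := le_lt_trans s0 st.
have [|B HB] := cseries_terms_bounded (Ha (t%:C)%C _).
  by rewrite /disc /= cabsR// ltW.
apply: (@series_le_cvg _ _ (fun n => B * (s / t) ^+ n)) => [n|n|n|].
- by rewrite mulr_ge0 ?cabs_ge0 ?exprn_ge0.
- rewrite mulr_ge0 ?exprn_ge0 ?divr_ge0// ?(ltW t0)//.
  exact: le_trans (cabs_ge0 _) (HB 0%N).
- rewrite expr_div_n mulrA ler_pdivlMr ?exprn_gt0// mulrAC.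
  rewrite ler_wpM2r ?exprn_ge0//.
  by have := HB n; rewrite cabsM cabsX cabsR// ltW.
- apply: is_cvg_geometric_series.
  by rewrite ger0_norm ?divr_ge0// ?(ltW t0)// ltr_pdivrMr// mul1r.
Qed.

(** On the circle of radius s the truncation differs from f by a tail that does not depend on the
    point, so the polynomial estimate applies with a bound slightly above the norm of f. *)
Lemma Hinf_horner_le a s N (w : R[i]) : Hinf a -> 0 <= s < 1 -> cabs w = s ->
  cabs (\poly_(n < N) a n).[w] <= Hinf_norm a +
    (limn (series (fun n => cabs (a n) * s ^+ n))
      - series (fun n => cabs (a n) * s ^+ n) N).
Proof.
move=> Ha s01 ws; have cg := Hinf_abs_cvg Ha s01.
have ug n : cabs (a n * w ^+ n) <= cabs (a n) * s ^+ n by rewrite cabsM cabsX ws.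
have dw : disc w by rewrite /disc /= ws; case/andP: s01.
have to := cseries_dominated ug cg.
rewrite horner_poly -[X in cabs X](subKr (csum (fun n => a n * w ^+ n))).
rewrite (le_trans (cabsB _ _))// lerD//; first exact: Hinf_norm_ge dw to.
exact: csum_tail.
Qed.

Lemma le_of_geometric_le (x y : R) k : 0 <= x ->
  (forall s, 0 < s < 1 -> x * s ^+ k <= y) -> x <= y.
Proof.
(* n + 2 rather than n + 1 keeps s positive at n = 0. *)
move=> x0 H; pose s n : R := 1 - n.+2%:R^-1.
have s01 n : 0 < s n < 1.
  by rewrite /s subr_gt0 invf_lt1 ?ltr0n// ltr1n /= ltrBlDr ltrDl invr_gt0 ltr0n.
have cs : s @ \oo --> (1 : R).
  rewrite -[X in _ --> X]subr0; apply: cvgB; first exact: cvg_cst.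
  have h : [sequence (@harmonic R) n.+1]_n @ \oo --> (0 : R).
    by rewrite (cvg_shiftS (@harmonic R)); exact: cvg_harmonic.
  exact: h.
have csk : (fun n => x * s n ^+ k) @ \oo --> x * 1 ^+ k.
  apply: cvgM; first exact: cvg_cst.
  exact: (@continuous_cvg _ _ _ _ _ _ (fun x : R => x ^+ k) _ (@exprn_continuous R k 1) cs).
rewrite expr1n mulr1 in csk; rewrite -(cvg_lim _ csk)//; apply: limr_le.
  by apply/cvg_ex; exists x.
by apply: nearW => n; exact: H.
Qed.

(** The polynomial estimate is applied to truncations of f; N goes to infinity at fixed s < 1, then
    s goes to 1. *)
Lemma Hinf_coef_mul_sqr_le a (p : {poly R[i]}) k : Hinf a ->
  cabs (\sum_(n < k.+1) a n * (p * p)`_(k - n))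
  <= Hinf_norm a * \sum_(i < size p) cabs p`_i ^+ 2.
Proof.
move=> Ha; apply: (@le_of_geometric_le _ _ k) => [|s s01]; first exact: cabs_ge0.
have [s0 s1] := andP s01; have s01' : 0 <= s < 1 by rewrite ltW.
set S := \sum_(i < size p) _.
pose tail N : R := limn (series (fun n => cabs (a n) * s ^+ n))
      - series (fun n => cabs (a n) * s ^+ n) N.
have tail0 : tail @ \oo --> (0 : R) by apply: nnseries_tail; exact: Hinf_abs_cvg.
(* N > k keeps a_0, ..., a_k in the truncation; the weights s^(2i) <= 1 are dropped. *)
have bound N : (k < N)%N -> cabs (\sum_(n < k.+1) a n * (p * p)`_(k - n)) * s ^+ k
    <= (Hinf_norm a + tail N) * S.
  move=> kN.
  have M0 : 0 <= Hinf_norm a + tail N.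
    exact: le_trans (cabs_ge0 _) (Hinf_horner_le N Ha s01' (cabsR (ltW s0))).
  have := @coef_mul_sqr_le R[i] (\poly_(n < N) a n) p (s%:C)%C
    (Hinf_norm a + tail N)%:C%C k.
  rewrite ler0c (ltW s0) => /(_ isT) H.
  have {H} := H _; rewrite coefM => H.
  have {H} : `|\sum_(n < k.+1) a n * (p * p)`_(k - n)| * (s%:C)%C ^+ k
    <= (Hinf_norm a + tail N)%:C%C * \sum_(i < size p) `|p`_i| ^+ 2 * (s%:C)%C ^+ (i + i).
    have -> : \sum_(n < k.+1) a n * (p * p)`_(k - n)
        = \sum_(n < k.+1) (\poly_(n < N) a n)`_n * (p * p)`_(k - n).
      apply: eq_bigr => n _; rewrite coef_poly (leq_trans (ltn_ord n) kN)//.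
    apply: H => w ws; rewrite -cabsE lecR; apply: Hinf_horner_le => //.
    by apply: (@complexI R); rewrite cabsE.
  rewrite -cabsE.
  under [X in _ <= _ * X]eq_bigr do rewrite -cabsE -!rmorphXn -rmorphM.
  rewrite -rmorph_sum -rmorphXn -!rmorphM /= lecR => /le_trans; apply.
  rewrite ler_wpM2l//; apply: ler_sum => i _.
  by rewrite ler_piMr ?sqr_ge0// exprn_ile1// ltW.
have lim : (fun N => (Hinf_norm a + tail N) * S) @ \oo --> (Hinf_norm a + 0) * S.
  by apply: cvgM; [apply: cvgD => //; exact: cvg_cst|exact: cvg_cst].
rewrite addr0 in lim; rewrite -(cvg_lim _ lim)//; apply: limr_ge.
  by apply/cvg_ex; eexists; exact: lim.
by exists k.+1 => // N /= kN; exact: bound.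
Qed.

(** The case p = 1 is Cauchy's estimate. *)
Lemma Hinf_coef_le a k : Hinf a -> cabs (a k) <= Hinf_norm a.
Proof.
move=> Ha; have := @Hinf_coef_mul_sqr_le a 1 k Ha.
rewrite size_poly1 big_ord1 coef1 cabs1 expr1n !mulr1.
rewrite big_ord_recr /= subnn coef1 mulr1 big1 ?add0r// => i _.
by rewrite coef1 subn_eq0 leqNgt ltn_ord mulr0.
Qed.

Definition harmonic_sum (k : nat) : R := \sum_(n < k.+1) n.+1%:R^-1.

Lemma Hinf_partial_sum_le a k : Hinf a ->
  cabs (\sum_(n < k.+1) a n) <= Hinf_norm a * harmonic_sum k.
Proof.
move=> Ha; have M0 := le_trans (cabs_ge0 _) (Hinf_coef_le 0 Ha).
(* Truncating (1 - z)^(-1/2) at degree k leaves the coefficients of its square unchanged up to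
   degree k, so they are those of 1/(1 - z). *)
pose p : {poly R[i]} := \poly_(i < k.+1) ((landau R i)%:C)%C.
have pp n : (n <= k)%N -> (p * p)`_n = 1.
  move=> nk; rewrite coefM -[RHS](_ : (1 : R)%:C%C = 1)// -(landau_convolution R n).
  rewrite rmorph_sum; apply: eq_bigr => i _; rewrite !coef_poly rmorphM.
  have ink : (i < k.+1)%N by rewrite (leq_trans (ltn_ord i)).
  by rewrite ink ltnS (leq_trans (leq_subr _ _) nk).
have := @Hinf_coef_mul_sqr_le a p k Ha.
under eq_bigr do rewrite pp ?leq_subr// mulr1.
move=> /le_trans; apply; rewrite ler_wpM2l//.
have pk : (size p <= k.+1)%N by exact: size_poly.
apply: (@le_trans _ _ (\sum_(i < k.+1) cabs p`_i ^+ 2)).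
  rewrite -!(big_mkord xpredT (fun i => cabs p`_i ^+ 2)).
  by rewrite (big_cat_nat _ pk)//= lerDl; apply: sumr_ge0 => i _; exact: sqr_ge0.
apply: ler_sum => i _; rewrite coef_poly ltn_ord cabsR ?landau_ge0//.
exact: landau_sqr_le.
Qed.

End BoundedHolomorphic.

(** * Moments of Carleson measures *)

Section Moments.
Variables (R : realType) (mu : {measure set R -> \bar R}) (r : R).
Hypothesis mu_fin : (mu (@unit_interval R) < +oo)%E.

Let measurable_I : measurable (@unit_interval R).
Proof. exact: measurable_itv. Qed.

Let measurable_pow n : measurable_fun (@unit_interval R) (fun t : R => t ^+ n).
Proof. exact: exprn_measurable. Qed.

Lemma unit_interval_pow_ge0 n (t : R) : unit_interval t -> (0 <= (t ^+ n)%:E)%E.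
Proof.
by rewrite /unit_interval /= in_itv /= lee_fin => /andP[t0 _]; exact: exprn_ge0.
Qed.

Lemma moment_integral_le n k : (n <= k)%N ->
  (\int[mu]_(t in @unit_interval R) (t ^+ k)%:E
    <= \int[mu]_(t in @unit_interval R) (t ^+ n)%:E)%E.
Proof.
move=> nk; apply: ge0_le_integral => //.
- exact: unit_interval_pow_ge0.
- exact/measurable_EFinP.
- exact/measurable_EFinP.
- move=> t; rewrite /unit_interval /= in_itv /= lee_fin => /andP[t0 t1].
  by rewrite ler_wiXn2l// ltW.
Qed.

(** The moment of order 0 is the finite mass of [0, 1) and dominates the others, so [fine] loses
    nothing. *)
Lemma moment_EFin n :
  ((moment mu n)%:E = \int[mu]_(t in @unit_interval R) (t ^+ n)%:E)%E.
Proof.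
rewrite /moment fineK// ge0_fin_numE; last first.
  by apply: integral_ge0; exact: unit_interval_pow_ge0.
apply: le_lt_trans (moment_integral_le (leq0n n)) _.
by under eq_integral do rewrite expr0; rewrite integral_cst// mul1e.
Qed.

Lemma moment_ge0 n : 0 <= moment mu n.
Proof.
by rewrite -lee_fin moment_EFin; apply: integral_ge0; exact: unit_interval_pow_ge0.
Qed.

Lemma moment_le n k : (n <= k)%N -> moment mu k <= moment mu n.
Proof. by move=> nk; rewrite -lee_fin !moment_EFin; exact: moment_integral_le. Qed.

(** The condition near 1 extends to [0, 1): below t0 the mass is at most that of [0, 1), and (1 -
    t)^r is at least (1 - t0)^r. The maximum with 0 guards against a negative K. *)
Lemma carleson_global : 0 <= r -> carleson mu r -> exists2 K : R, 0 <= K &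
  forall t : R, 0 <= t < 1 -> (mu `[t, 1%R[%classic <= (K * (1 - t) `^ r)%:E)%E.
Proof.
move=> r0 [K [t0 [t01 HK]]].
pose m := fine (mu (@unit_interval R)).
have mE : mu (@unit_interval R) = m%:E.
  by rewrite /m fineK// ge0_fin_numE.
have m0 : 0 <= m by rewrite -lee_fin -mE.
exists (Num.max 0 K + m * (1 - t0) `^ (- r)).
  by rewrite addr_ge0 ?mulr_ge0 ?powR_ge0// le_max lexx.
move=> t /andP[t_ge0 t1]; have [tt|tt] := leP t0 t.
  apply: le_trans (HK _ tt t1) _; rewrite lee_fin ler_wpM2r ?powR_ge0//.
  by rewrite ler_wpDr ?mulr_ge0 ?powR_ge0// le_max lexx orbT.
apply: (@le_trans _ _ m%:E).
  rewrite -mE; apply: le_measure; rewrite ?inE; first 2 last.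
    move=> x; rewrite /unit_interval /= !in_itv /= => /andP[tx ->]; rewrite andbT.
    exact: le_trans t_ge0 tx.
  - exact: measurable_itv.
  - exact: measurable_itv.
rewrite lee_fin mulrDl ler_wpDl ?mulr_ge0 ?powR_ge0 ?le_max ?lexx//.
rewrite -mulrA ler_peMr// powRN mulrC ler_pdivlMr ?powR_gt0 ?subr_gt0// mul1r.
by apply: ge0_ler_powR; rewrite ?nnegrE//; lra.
Qed.

(** A power-law majorant of e^(1-j): multiplied by the factor (j+1)^r of the Carleson bound it
    leaves a [decay] series, convergent for m > r + 1. *)
Let weight (m j : nat) : R := expR 2 * m`!%:R * decay m%:R j.

(** Write e^(1-j) = e^2 e^-(j+1) and use e^x >= x^m / m! at x = j + 1. *)
Lemma expR_weight m j : (0 < m)%N -> expR (1 - j%:R) <= weight m j.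
Proof.
case: m => // m _; rewrite /weight /decay powRN powR_mulrn// ler_pdivlMr ?exprn_gt0//.
have -> : (1 - j%:R = 2 - j.+1%:R :> R) by rewrite -natr1; ring.
rewrite expRD expRN -mulrA ler_wpM2l ?expR_ge0// mulrC ler_pdivrMr ?expR_gt0//.
rewrite mulrC -ler_pdivrMr ?ltr0n ?fact_gt0//.
by apply: le_trans (expR_ge1Dxn m (ler0n _ _)); rewrite lerDr.
Qed.

(** Tails instead of the cells between consecutive endpoints, because these are the sets that the
    Carleson condition measures; each cell is contained in its tail. *)
Let tail_itv (n j : nat) : set R := `[1 - j.+1%:R / n.+1%:R, 1%R[%classic.

Lemma pow_le_step m n (t : R) : (0 < m)%N -> unit_interval t ->
  t ^+ n <= \sum_(j < n.+1) weight m j * \1_(tail_itv n j) t.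
Proof.
move=> m0; rewrite /unit_interval /= in_itv /= => /andP[t0 t1].
have N0 : 0 < n.+1%:R :> R by rewrite ltr0n.
have w0 j : 0 <= weight m j by rewrite !mulr_ge0 ?expR_ge0 ?decay_ge0.
(* The least such j locates the cell of t: it gives t <= 1 - j/(n+1), whence t^n <=
   exp(-nj/(n+1)). *)
have ex : exists j, n.+1%:R * (1 - t) <= j.+1%:R.
  by exists n; rewrite ler_piMr// gerBl.
case: (ex_minnP ex) => j jP jmin.
have jn : (j < n.+1)%N by rewrite ltnS jmin// ler_piMr// gerBl.
rewrite (bigD1 (Ordinal jn))//= -[leLHS]addr0 lerD//; last first.
  by apply: sumr_ge0 => i _; rewrite mulr_ge0// indicE.
have -> : \1_(tail_itv n j) t = 1 :> R.
  rewrite indicE mem_set// /tail_itv /= in_itv /= t1 andbT.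
  by rewrite lerBlDr -lerBlDl ler_pdivlMr// mulrC.
rewrite mulr1 (le_trans _ (expR_weight j m0))//.
have tj : t <= 1 - j%:R / n.+1%:R.
  rewrite lerBrDr -lerBrDl ler_pdivrMr// mulrC.
  case: j {jP jn} jmin => [|j] jmin; first by rewrite mulr_ge0// ?ltW// subr_gt0.
  by rewrite leNgt; apply/negP => /ltW /jmin; rewrite ltnn.
apply: (@le_trans _ _ (expR (- (j%:R / n.+1%:R)) ^+ n)).
  apply: lerXn2r; rewrite ?nnegrE ?expR_ge0//.
  by apply: le_trans tj _; exact: expR_ge1Dx.
rewrite -expRM_natl ler_expR -subr_ge0.
(* -nj/(n+1) <= 1 - j because j <= n + 1; passing from n + 1 to n costs the 1 in e^(1-j). *)
have -> : 1 - j%:R - n%:R * - (j%:R / n.+1%:R) = (n.+1%:R - j%:R) / n.+1%:R :> R.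
  by rewrite -natr1; field; rewrite natr1 gt_eqF.
by rewrite divr_ge0 ?subr_ge0 ?ler_nat// ltnW.
Qed.

Lemma moment_decay : 1 < r -> carleson mu r ->
  exists2 C : R, 0 <= C & forall n, moment mu n <= C * decay r n.
Proof.
move=> r1 Hc; have r0 : 0 <= r by rewrite (le_trans ler01)// ltW.
have [K K0 HK] := carleson_global r0 Hc.
(* This makes m > r + 1, so the series of (j+1)^(r-m) converges. *)
pose m := (Num.trunc r).+3.
have mr : 1 < m%:R - r.
  have := truncnS_gt r; rewrite /m -[_.+3]addn2 natrD; lra.
pose E : R := expR 2 * m`!%:R.
have E0 : 0 <= E by rewrite mulr_ge0 ?expR_ge0.
pose Z := limn (series (decay (m%:R - r))).
have Z0 : 0 <= Z.
  by apply: nnseries_lim_ge0 => [k|]; [exact: decay_ge0|exact: cvg_decay].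
exists (K * E * Z) => [|n]; first by rewrite !mulr_ge0.
have w0 j : 0 <= weight m j by rewrite !mulr_ge0 ?expR_ge0 ?decay_ge0.
rewrite -lee_fin moment_EFin.
have mA j : measurable (tail_itv n j) by exact: measurable_itv.
have mf j : measurable_fun (@unit_interval R) (EFin \o (fun t : R => \1_(tail_itv n j) t)).
  by apply/measurable_EFinP; exact: measurable_indic.
apply: (@le_trans _ _ (\int[mu]_(t in @unit_interval R)
    \sum_(j < n.+1) ((weight m j)%:E * (\1_(tail_itv n j) t)%:E))%E).
  apply: ge0_le_integral => //.
  - exact: unit_interval_pow_ge0.
  - exact/measurable_EFinP.
  - apply: emeasurable_sum => j; apply: measurable_funeM; exact: mf.
  - move=> t It; under eq_bigr do rewrite -EFinM; rewrite sumEFin lee_fin.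
    exact: pow_le_step.
rewrite ge0_integral_sum//; last 2 first.
- by move=> j; apply: measurable_funeM; exact: mf.
- by move=> j t _; rewrite -EFinM lee_fin mulr_ge0// indicE.
(* The j-th tail has mass at most K ((j+1)/(n+1))^r; with its weight this is a constant times
   (j+1)^(r-m) (n+1)^-r, and the sum over j is bounded uniformly in n. *)
apply: (@le_trans _ _ (\sum_(j < n.+1) (K * E * decay (m%:R - r) j * decay r n)%:E)%E).
  apply: lee_sum => j _; rewrite ge0_integralZl; [|exact: measurable_I|exact: mf
    |by move=> t _; rewrite lee_fin indicE|by rewrite lee_fin].
  rewrite integral_indic//.
  have N0 : 0 < n.+1%:R :> R by rewrite ltr0n.
  have jN0 : 0 <= 1 - j.+1%:R / n.+1%:R :> R.
    by rewrite subr_ge0 ler_pdivrMr// mul1r ler_nat.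
  have jN1 : 1 - j.+1%:R / n.+1%:R < 1 :> R by rewrite gtrBl divr_gt0// ltr0n.
  rewrite setIidl; last first.
    move=> t; rewrite /tail_itv /unit_interval /= !in_itv /= => /andP[jt ->].
    by rewrite (le_trans jN0 jt).
  apply: (@le_trans _ _ ((weight m j)%:E * (K * (j.+1%:R / n.+1%:R) `^ r)%:E)%E).
    by rewrite lee_wpmul2l ?lee_fin// (le_trans (HK _ _)) ?jN0 ?jN1// lee_fin subKr.
  rewrite -EFinM lee_fin /weight -/E [decay (_ - _) j]decayD powRM//.
  rewrite -[_^-1]powR_inv1// -powRrM mulN1r.
  rewrite [decay (- r) j](_ : _ = j.+1%:R `^ r); last by rewrite /decay opprK.
  by rewrite le_eqVlt; apply/orP; left; apply/eqP; rewrite /decay; ring.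
rewrite sumEFin lee_fin -mulr_suml -mulr_sumr -seriesEord.
rewrite ler_wpM2r ?decay_ge0// ler_wpM2l ?mulr_ge0//.
by apply: nnseries_le_lim => [k|]; [exact: decay_ge0|exact: cvg_decay].
Qed.

End Moments.

(** * Compactness on the Hardy space *)

Section HilbertSchmidt.
Variable R : realType.
Implicit Types (a b : nat -> R[i]) (c w : nat -> R) (T : (nat -> R[i]) -> nat -> R[i]).

Lemma lim_series_le_split (g h : nat -> R) K : (forall n, 0 <= g n <= h n) ->
  cvgn (series h) ->
  limn (series g) <= series g K + (limn (series h) - series h K).
Proof.
move=> gh ch.
have cg : cvgn (series g).
  apply: series_le_cvg ch => n; have /andP[g0 gn] := gh n => //.
  exact: le_trans gn.
have chg : cvgn (series (h - g)) by exact: is_cvg_seriesB.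
have hg0 n : 0 <= (h - g) n by have /andP[_] := gh n; rewrite -subr_ge0.
have := nnseries_le_lim K hg0 chg.
rewrite lim_seriesB// [leLHS](_ : _ = series h K - series g K); last first.
  by rewrite /series /= -sumrB.
by move=> ?; lra.
Qed.

(** Convergence in the Hilbert cube needs only finitely many coordinates to be close: the common
    majorant [h] controls the tail. *)
Lemma H2_norm_split a (h : nat -> R) K (d : R) :
  (forall k, cabs (a k) ^+ 2 <= h k) -> cvgn (series h) ->
  (forall k, (k < K)%N -> cabs (a k) ^+ 2 <= d) ->
  H2_norm a ^+ 2 <= K%:R * d + (limn (series h) - series h K).
Proof.
move=> ah ch ad; have Ha : H2 a.
  apply/H2P; apply: series_le_cvg ch => n //=; first exact: sqr_ge0.
  exact: le_trans (sqr_ge0 _) (ah n).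
rewrite H2_normK// (le_trans (lim_series_le_split (h := h) K _ _))//.
  by move=> n; rewrite sqr_ge0 ah.
rewrite lerD2r seriesEord mulr_natl.
have -> : d *+ K = \sum_(i < K) d by rewrite sumr_const card_ord.
by apply: ler_sum => i _; exact: ad.
Qed.

(** By Tychonoff the product of the segments is compact, so the sequence has a cluster point, and
    closeness in finitely many coordinates is a neighbourhood of it. This replaces a diagonal
    extraction. *)
Lemma cluster_coordinates (J : eqType) (f : nat -> J -> R) (w : J -> R) :
  (forall n j, `|f n j| <= w j) ->
  exists2 g : J -> R, (forall j, `|g j| <= w j) &
    forall (s : seq J) (e : R) m, 0 < e ->
      exists2 n, (m <= n)%N & forall j, j \in s -> `|f n j - g j| < e.
Proof.
move=> fw.
have cA j : compact (`[- w j, w j]%classic : set R) by exact: segment_compact.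
have FA : (f @ \oo) [set h : J -> R | forall j, `[- w j, w j]%classic (h j)].
  by exists 0%N => // n _ j; rewrite /= in_itv /= -ler_norml.
have [g [gA gF]] := @tychonoff J (fun=> R) (fun j => `[- w j, w j]%classic) cA
  (f @ \oo) _ FA.
exists g => [j|s e m e0].
  by have := gA j; rewrite /= in_itv /= -ler_norml.
have nbg : nbhs g [set h : J -> R | forall j, j \in s -> `|h j - g j| < e].
  elim: s => [|i s IH]; first by apply: filterS filterT => h _ j; rewrite in_nil.
  have pi : nbhs g [set h : J -> R | `|h i - g i| < e].
    have pc := @proj_continuous J (fun=> R) i g.
    apply: (pc [set x : R | `|x - g i| < e]).
    by apply/nbhs_ballP; exists e => // x /=; rewrite distrC.
  apply: filterS2 pi IH => h hi hs j; rewrite inE => /predU1P[->//|].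
  exact: hs.
have Fm : (f @ \oo) [set f n | n in [set n | (m <= n)%N]].
  by exists m => // n /= mn; exists n.
have [_ [[n mn <-] hn]] := gF _ _ Fm nbg.
by exists n.
Qed.

Lemma hilbert_cube_subsequence (x : nat -> nat -> R[i]) w :
  (forall j k, cabs (x j k) <= w k) -> cvgn (series (fun k => w k ^+ 2)) ->
  exists (s : nat -> nat) b, (forall i j, (i < j)%N -> (s i < s j)%N) /\ H2 b /\
    (fun j => H2_norm (fun k => x (s j) k - b k)) @ \oo --> (0 : R).
Proof.
move=> xw cw.
have w0 k : 0 <= w k by rewrite (le_trans _ (xw 0%N k))// cabs_ge0.
(* Real and imaginary parts are separate coordinates, so b is bounded by 2w, x - b by 3w, and the
   square by the 9 w^2 of [h]. *)
pose f (n : nat) (i : bool * nat) : R :=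
  if i.1 then complex.Re (x n i.2) else complex.Im (x n i.2).
have [|g gw gf] := @cluster_coordinates _ f (fun i => w i.2).
  by move=> n [[] k] /=; rewrite (le_trans _ (xw n k)) ?ler_Re_cabs ?ler_Im_cabs.
pose b k : R[i] := Complex (g (true, k)) (g (false, k)).
have bw k : cabs (b k) <= 2 * w k.
  by rewrite (le_trans (cabs_le_ReIm _))// mulr_natl mulr2n lerD ?(gw (_, k)).
have Hb : H2 b.
  apply: (H2_dominated bw); under eq_fun do rewrite exprMn.
  exact: cvg_seriesM.
pose h k : R := 9 * w k ^+ 2.
have ch : cvgn (series h) by exact: cvg_seriesM.
have dh n k : cabs (x n k - b k) ^+ 2 <= h k.
  rewrite (_ : h k = (3 * w k) ^+ 2); last by rewrite /h; ring.
  rewrite ler_pXn2r ?nnegrE ?cabs_ge0 ?mulr_ge0// (le_trans (cabsB _ _))//.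
  by have := xw n k; have := bw k; lra.
have close (e : R) m : 0 < e ->
    exists2 n, (m <= n)%N & H2_norm (fun k => x n k - b k) <= e.
  move=> e0; have e20 : 0 < e ^+ 2 / 2 by rewrite divr_gt0 ?exprn_gt0.
  have /cvgr0Pnorm_le/(_ _ e20)[K _ /(_ K (leqnn K)) tK] := nnseries_tail ch.
  (* Each of the first K coordinates has modulus at most 2d, and 4d^2 <= 4d since d <= 1; together
     their squares contribute at most e^2/2, and the tail of [h] takes the other half. *)
  pose d := Num.min 1 (e ^+ 2 / (8 * K.+1%:R)).
  have d0 : 0 < d by rewrite lt_min ltr01 divr_gt0 ?exprn_gt0 ?mulr_gt0.
  have [n mn nd] := gf [seq (re, k) | re <- [:: true; false], k <- iota 0 K] d m d0.
  exists n => //; rewrite -(@ler_pXn2r _ 2) ?nnegrE ?H2_norm_ge0 ?(ltW e0)//.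
  apply: le_trans (@H2_norm_split _ h K (4 * d) (dh n) ch _) _.
    move=> k kK; have kmem re : (re, k) \in [seq (re, k) | re <- [:: true; false], k <- iota 0 K].
      by apply: allpairs_f; [case: re; rewrite !inE|rewrite mem_iota add0n].
    have c2 : cabs (x n k - b k) <= 2 * d.
      rewrite (le_trans (cabs_le_ReIm _))// mulr_natl mulr2n.
      have := ltW (nd _ (kmem true)); have := ltW (nd _ (kmem false)).
      by rewrite /f /=; case: (x n k) => ? ? /= ? ?; rewrite lerD.
    have d1 : d <= 1 by rewrite ge_min lexx.
    apply: (@le_trans _ _ ((2 * d) ^+ 2)).
      by rewrite ler_pXn2r ?nnegrE ?cabs_ge0 ?mulr_ge0 ?(ltW d0).
    by rewrite exprMn expr2 -natrM ler_wpM2l// expr2 ler_piMr// ltW.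
  have Kd : K%:R * (4 * d) <= e ^+ 2 / 2.
    have dK : d <= e ^+ 2 / (8 * K.+1%:R) by rewrite ge_min lexx orbT.
    apply: (@le_trans _ _ (K.+1%:R * (4 * d))).
      by rewrite ler_wpM2r ?mulr_ge0 ?(ltW d0)// ler_nat.
    apply: (@le_trans _ _ (K.+1%:R * (4 * (e ^+ 2 / (8 * K.+1%:R))))).
      by rewrite !ler_wpM2l.
    have : K.+1%:R != 0 :> R by rewrite pnatr_eq0.
    move: K.+1%:R => y y0; rewrite le_eqVlt; apply/orP; left; apply/eqP.
    by field.
  by have := le_trans (ler_norm _) tK; lra.
have /choice[sel selP] (p : nat * nat) : exists n, (p.2 <= n)%N /\
    H2_norm (fun k => x n k - b k) <= p.1.+1%:R^-1.
  have [|n pn np] := @close p.1.+1%:R^-1 p.2; first by rewrite invr_gt0.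
  by exists n.
(* The lower bound handed to [sel] is one more than the previous index, which makes s strictly
   increasing, while the tolerance 1/(j+1) tends to 0. *)
pose s := fix s j := if j is i.+1 then sel (j, (s i).+1) else sel (0%N, 0%N).
have sP j : H2_norm (fun k => x (s j) k - b k) <= j.+1%:R^-1.
  by case: j => [|j]; [have [] := selP (0%N, 0%N)|have [] := selP (j.+1, (s j).+1)].
exists s, b; split; [|split=> //].
  by apply: (homo_ltn ltn_trans) => j; have [] := selP (j.+1, (s j).+1).
refine (squeeze0 _ (@cvg_harmonic R)) => j.
by rewrite H2_norm_ge0 sP.
Qed.

Lemma compact_H2_dominated T c : (forall k, 0 <= c k) ->
  cvgn (series (fun k => c k ^+ 2)) ->
  (forall a k, H2 a -> cabs (T a k) <= c k * H2_norm a) ->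
  maps_into (@H2 R) (@H2 R) T /\ compact_H2 T.
Proof.
move=> c0 cc Tc; have cM (M : R) : cvgn (series (fun k => (c k * M) ^+ 2)).
  under eq_fun do rewrite exprMn mulrC.
  exact: cvg_seriesM.
split=> [a Ha|a M aM].
  by apply: (@H2_dominated _ _ (fun k => c k * H2_norm a)) => // k; exact: Tc.
apply: (@hilbert_cube_subsequence (fun j => T (a j)) (fun k => c k * M)) => // j k.
by have [Ha HM] := aM j; rewrite (le_trans (Tc _ _ Ha))// ler_wpM2l.
Qed.

End HilbertSchmidt.

(** * Interchange of double series *)

Section DoubleSeries.
Variable R : realType.
Implicit Types (u : nat -> R[i]) (w : nat -> nat -> R[i]) (p q : nat -> R).

Lemma csumMl u (c : R[i]) : cseries_cvg u ->
  csum (fun n => c * u n) = c * csum u.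
Proof.
move=> [l ul]; rewrite (cseries_csum ul); apply: cseries_csum.
have z : cseries_to (fun _ => 0 : R[i]) 0.
  rewrite /cseries_to; under [X in ccvg_to X _]funext => N do rewrite big1//.
  by rewrite /ccvg_to subrr cabs0; exact: cvg_cst.
have := cseriesD_scale c z ul; rewrite add0r.
by under [X in cseries_to X _]funext => n do rewrite add0r.
Qed.

Lemma csum_conjc u : cseries_cvg u ->
  csum (fun n => conjc (u n)) = conjc (csum u).
Proof.
move=> [l ul]; rewrite (cseries_csum ul); apply: cseries_csum.
rewrite /cseries_to /ccvg_to; under eq_fun do rewrite -rmorph_sum -rmorphB cabsJ.
exact: ul.
Qed.

(** Squares, because exchanging their two finite sums gives squares again, so both iterated sums are
    limits of one sequence. The distance from a square to N full rows is at most P (Q - Q_N), with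
    Q_N the partial sum of q. *)
Lemma square_sums_cvg w p q : (forall k n, cabs (w k n) <= p k * q n) ->
  (forall k, 0 <= p k) -> (forall n, 0 <= q n) ->
  cvgn (series p) -> cvgn (series q) ->
  ccvg_to (fun N => \sum_(k < N) \sum_(n < N) w k n)
    (csum (fun k => csum (w k))).
Proof.
move=> wpq p0 q0 cp cq.
pose P := limn (series p); pose Q := limn (series q).
have row k : cvgn (series (fun n => p k * q n)) by exact: cvg_seriesM.
have row_le k : cabs (csum (w k)) <= Q * p k.
  by rewrite mulrC -lim_seriesM//; exact: csum_le.
have cQp : cvgn (series (fun k => Q * p k)) by exact: cvg_seriesM.
have L := cseries_dominated row_le cQp.
have B : (fun N => cabs (\sum_(k < N) csum (w k) - csum (fun k => csum (w k)))
    + P * (Q - series q N)) @ \oo --> (0 + P * 0 : R).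
  by apply: cvgD; [exact: L|apply: cvgMl_tmp; exact: nnseries_tail].
rewrite mulr0 addr0 in B; refine (squeeze0 _ B) => N; rewrite cabs_ge0 /=.
set S := \sum_(k < N) \sum_(n < N) w k n; set l := csum (fun k => _).
rewrite (_ : S - l = (\sum_(k < N) csum (w k) - l)
  - (\sum_(k < N) csum (w k) - S)); last by ring.
rewrite (le_trans (cabsB _ _))// lerD2l -sumrB (le_trans (cabs_sum _ _ _))//.
apply: (@le_trans _ _ (\sum_(k < N) p k * (Q - series q N))).
  apply: ler_sum => k _; apply: le_trans (csum_tail N (wpq k) (row k)) _.
  rewrite lim_seriesM// mulrBr lerD2l lerN2 !seriesEord mulr_sumr.
  exact: lexx.
rewrite -mulr_suml -seriesEord ler_wpM2r ?nnseries_le_lim//.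
by rewrite subr_ge0 nnseries_le_lim.
Qed.

Lemma csum_exchange w p q : (forall k n, cabs (w k n) <= p k * q n) ->
  (forall k, 0 <= p k) -> (forall n, 0 <= q n) ->
  cvgn (series p) -> cvgn (series q) ->
  csum (fun k => csum (w k)) = csum (fun n => csum (fun k => w k n)).
Proof.
move=> wpq p0 q0 cp cq.
rewrite -(ccvg_clim (square_sums_cvg wpq p0 q0 cp cq)).
have wqp n k : cabs (w k n) <= q n * p k by rewrite mulrC.
rewrite -(ccvg_clim (square_sums_cvg wqp q0 p0 cq cp)).
by congr clim; apply/funext => N; rewrite exchange_big.
Qed.

End DoubleSeries.

(** * Hankel and Cesaro-type operators *)

Lemma sum_by_parts (A : comNzRingType) (f x : nat -> A) N :
  \sum_(n < N.+1) f n * x n = f N * (\sum_(n < N.+1) x n)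
    + \sum_(j < N) (f j - f j.+1) * (\sum_(n < j.+1) x n).
Proof.
elim: N => [|N IH]; first by rewrite !big_ord1 big_ord0 addr0.
rewrite big_ord_recr /= IH [\sum_(n < N.+2) x n]big_ord_recr.
rewrite [\sum_(j < N.+1) (f j - _) * _]big_ord_recr /=.
by ring.
Qed.

Section MomentOperators.
Variables (R : realType) (m : nat -> R) (C r : R).
Hypotheses (m_ge0 : forall n, 0 <= m n)
  (m_le : forall n k, (n <= k)%N -> m k <= m n)
  (C_ge0 : 0 <= C) (m_decay : forall n, m n <= C * decay r n).
Implicit Types (a b : nat -> R[i]) (p q e : R).

(** The measure enters only through m; for the moment sequence these definitions are convertible to
    [Hmu_series], [Hmu] and [Cmu], and the final proof relies on this. *)
Definition hankel_series a k : nat -> R[i] := fun n => (m (n + k))%:C%C * a n.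
Definition hankel a : nat -> R[i] := fun k => csum (hankel_series a k).
Definition cesaro a : nat -> R[i] := fun k => (m k)%:C%C * \sum_(n < k.+1) a n.

Lemma moment_split p q n k : 0 <= p -> 0 <= q -> r = p + q ->
  m (n + k) <= C * decay p k * decay q n.
Proof.
move=> p0 q0 rpq; rewrite (le_trans (m_decay _))// -mulrA ler_wpM2l// rpq.
exact: decay_split.
Qed.

Lemma cesaro_linear a b (lam : R[i]) k :
  cesaro (fun n => a n + lam * b n) k = cesaro a k + lam * cesaro b k.
Proof.
by rewrite /cesaro big_split /= -mulr_sumr mulrDr [in RHS]mulrCA.
Qed.

(** [csum] is known to be additive only on convergent series, hence the hypothesis on [X], which
    will be H^infty or H^2. *)
Lemma hankel_linear (X : (nat -> R[i]) -> Prop) a b (lam : R[i]) k :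
  (forall a, X a -> forall k, cseries_cvg (hankel_series a k)) -> X a -> X b ->
  hankel (fun n => a n + lam * b n) k = hankel a k + lam * hankel b k.
Proof.
move=> cX Xa Xb; have [la ca] := cX _ Xa k; have [lb cb] := cX _ Xb k.
rewrite /hankel (cseries_csum ca) (cseries_csum cb); apply: cseries_csum.
rewrite (_ : hankel_series _ k = (fun n => hankel_series a k n
  + lam * hankel_series b k n)); first exact: cseriesD_scale.
by apply/funext => n; rewrite /hankel_series mulrDr mulrCA.
Qed.

Let l2norm q : R := Num.sqrt (limn (series (fun n => decay q n ^+ 2))).

Lemma cvg_decay_sqr q : 1 < q + q -> cvgn (series (fun n => decay q n ^+ 2)).
Proof. by move=> q1; under eq_fun do rewrite decay_sqr; exact: cvg_decay. Qed.

Lemma H2_hankel_dominated p q a k : 0 <= p -> 0 <= q -> r = p + q -> 1 < q + q ->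
  H2 a ->
  (forall n, cabs (hankel_series a k n) <=
     C * decay p k * (decay q n * cabs (a n))) /\
  cvgn (series (fun n => C * decay p k * (decay q n * cabs (a n)))).
Proof.
move=> p0 q0 rpq q1 Ha; split=> [n|].
  rewrite cabsM cabsR// mulrA ler_wpM2r ?cabs_ge0//.
  exact: moment_split.
apply: cvg_seriesM; apply: H2_pairing_cvg => //; last exact: cvg_decay_sqr.
by move=> n; exact: decay_ge0.
Qed.

Lemma H2_hankel_cvg p q a k : 0 <= p -> 0 <= q -> r = p + q -> 1 < q + q ->
  H2 a -> cseries_cvg (hankel_series a k).
Proof.
move=> p0 q0 rpq q1 Ha; have [au cu] := H2_hankel_dominated k p0 q0 rpq q1 Ha.
by eexists; exact: cseries_dominated au cu.
Qed.

Lemma H2_hankel_le p q a k : 0 <= p -> 0 <= q -> r = p + q -> 1 < q + q -> H2 a ->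
  cabs (hankel a k) <= C * l2norm q * decay p k * H2_norm a.
Proof.
move=> p0 q0 rpq q1 Ha; have [au cu] := H2_hankel_dominated k p0 q0 rpq q1 Ha.
apply: le_trans (csum_le au cu) _; rewrite lim_seriesM; last first.
  apply: H2_pairing_cvg => //; last exact: cvg_decay_sqr.
  by move=> n; exact: decay_ge0.
rewrite [leRHS](_ : _ = C * decay p k * (l2norm q * H2_norm a)); last by ring.
rewrite ler_wpM2l ?mulr_ge0 ?decay_ge0//.
apply: H2_pairing_lim_le => //; last exact: cvg_decay_sqr.
by move=> n; exact: decay_ge0.
Qed.

Lemma H2_cesaro_le p q a k : 0 <= p -> 0 <= q -> r = p + q -> 1 < q + q -> H2 a ->
  cabs (cesaro a k) <= C * l2norm q * decay p k * H2_norm a.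
Proof.
move=> p0 q0 rpq q1 Ha; rewrite cabsM cabsR//.
apply: (@le_trans _ _ (C * decay p k * series (fun n => decay q n * cabs (a n)) k.+1)).
  rewrite seriesEord mulr_sumr.
  apply: (@le_trans _ _ (\sum_(n < k.+1) m k * cabs (a n))).
    by rewrite -mulr_sumr ler_wpM2l// cabs_sum.
  apply: ler_sum => n _; rewrite mulrA ler_wpM2r ?cabs_ge0//.
  (* Only n <= k occurs, so (k+1)^-q <= (n+1)^-q and the triangular matrix gets the same product
     bound as the Hankel one. *)
  rewrite (le_trans (m_decay _))// -mulrA ler_wpM2l// rpq decayD.
  by rewrite ler_wpM2l ?decay_ge0// decay_le_index// -ltnS.
rewrite [leRHS](_ : _ = C * decay p k * (l2norm q * H2_norm a)); last by ring.
rewrite ler_wpM2l ?mulr_ge0 ?decay_ge0//.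
apply: H2_pairing_le => //; last exact: cvg_decay_sqr.
by move=> n; exact: decay_ge0.
Qed.

(** Both sides are iterated sums of m_(n+k) a_n conj(b_k), whose kernel is real and symmetric.
    Halving the exponent r dominates it by a product of two summable sequences, which permits the
    exchange. *)
Lemma H2_hankel_selfadjoint a b : 1 < r -> H2 a -> H2 b ->
  H2_inner (hankel a) b = H2_inner a (hankel b).
Proof.
move=> r1 Ha Hb; pose q := r / 2.
have q0 : 0 <= q by rewrite /q; lra.
have rq : r = q + q by rewrite /q; lra.
have q1 : 1 < q + q by rewrite -rq.
have pair c : H2 c -> cvgn (series (fun n => decay q n * cabs (c n))).
  move=> Hc; apply: H2_pairing_cvg => //; last exact: cvg_decay_sqr.
  by move=> n; exact: decay_ge0.
have cvH c k : H2 c -> cseries_cvg (hankel_series c k) by exact: (H2_hankel_cvg k q0 q0 rq q1).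
pose w k n := conjc (b k) * hankel_series a k n.
have wle k n : cabs (w k n) <=
    C * (decay q k * cabs (b k)) * (decay q n * cabs (a n)).
  rewrite /w cabsM cabsJ.
  have [H _] := H2_hankel_dominated k q0 q0 rq q1 Ha.
  apply: le_trans (ler_wpM2l (cabs_ge0 _) (H n)) _.
  by rewrite le_eqVlt; apply/orP; left; apply/eqP; ring.
have -> : H2_inner (hankel a) b = csum (fun k => csum (w k)).
  rewrite /H2_inner; congr csum; apply/funext => k.
  exact: etrans (mulrC _ _) (esym (csumMl (conjc (b k)) (cvH a k Ha))).
rewrite (csum_exchange wle); last 4 first.
- by move=> k; rewrite !mulr_ge0 ?decay_ge0 ?cabs_ge0.
- by move=> n; rewrite mulr_ge0 ?decay_ge0 ?cabs_ge0.
- by apply: cvg_seriesM; exact: pair.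
- exact: pair.
rewrite /H2_inner; congr csum; apply/funext => n.
rewrite -(csum_conjc (cvH b n Hb)).
have cb : cseries_cvg (fun k => conjc (hankel_series b n k)).
  have [l bl] := cvH b n Hb; exists (conjc l).
  rewrite /cseries_to /ccvg_to; under eq_fun do rewrite -rmorph_sum -rmorphB cabsJ.
  exact: bl.
rewrite -(csumMl (a n) cb).
congr csum; apply/funext => k; rewrite /w /hankel_series addnC.
have conjcM (x y : R[i]) : conjc (x * y) = conjc x * conjc y by exact: rmorphM.
by rewrite conjcM conjc_real; ring.
Qed.

(* Summation by parts moves the bound on the partial sums of [a] onto the
   decreasing sequence [m] and back. *)
Lemma hankel_partial_le a (M : R) N k :
  (forall j, cabs (\sum_(n < j.+1) a n) <= M * harmonic_sum R j) ->
  cabs (\sum_(n < N) hankel_series a k n)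
    <= M * \sum_(n < N) m (n + k) * n.+1%:R^-1.
Proof.
move=> aM; case: N => [|N]; first by rewrite !big_ord0 cabs0 mulr0.
rewrite (sum_by_parts (fun n => (m (n + k))%:C%C) a).
rewrite (sum_by_parts (fun n => m (n + k)) (fun n => n.+1%:R^-1)).
rewrite mulrDr (le_trans (cabsD _ _))// lerD//.
  by rewrite cabsM cabsR// mulrCA ler_wpM2l// aM.
rewrite mulr_sumr (le_trans (cabs_sum _ _ _))//; apply: ler_sum => j _.
rewrite -rmorphB cabsM cabsR; last by rewrite subr_ge0 m_le// leq_add2r.
by rewrite mulrCA ler_wpM2l ?aM// subr_ge0 m_le// leq_add2r.
Qed.

Lemma Hinf_hankel_cvg a k : 1 < r -> Hinf a -> cseries_cvg (hankel_series a k).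
Proof.
move=> r1 Ha; have r0 : 0 <= r by lra.
eexists; apply: (@cseries_dominated _ _ (fun n => C * Hinf_norm a * decay r n)).
  move=> n; rewrite cabsM cabsR// mulrAC ler_pM ?cabs_ge0 ?Hinf_coef_le//.
  rewrite (le_trans (m_decay _))// ler_wpM2l// decay_le_index//.
  exact: leq_addr.
by apply: cvg_seriesM; exact: cvg_decay.
Qed.

Lemma Hinf_norm_ge0 a : Hinf a -> 0 <= Hinf_norm a.
Proof. by move=> /(Hinf_coef_le 0); apply: le_trans; exact: cabs_ge0. Qed.

(** The factor 1/(n+1) raises the exponent q to q + 1, so any q > 0 suffices and p can exceed 1 as
    soon as r > 1. *)
Lemma Hinf_hankel_le p q a k : 0 <= p -> 0 < q -> r = p + q -> 1 < r -> Hinf a ->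
  cabs (hankel a k)
    <= C * limn (series (decay (q + 1))) * decay p k * Hinf_norm a.
Proof.
move=> p0 q0 rpq r1 Ha; have [l al] := Hinf_hankel_cvg k r1 Ha.
have M0 := Hinf_norm_ge0 Ha.
rewrite /hankel (cseries_csum al); apply: (ccvg_le al) => N.
apply: le_trans (hankel_partial_le _ _ (fun j => Hinf_partial_sum_le j Ha)) _.
rewrite [leRHS](_ : _ = Hinf_norm a * (C * decay p k * limn (series (decay (q + 1)))));
  last by ring.
rewrite ler_wpM2l//.
apply: (@le_trans _ _ (C * decay p k * series (decay (q + 1)) N)).
  rewrite seriesEord mulr_sumr; apply: ler_sum => n _.
  rewrite decayD decay1 mulrA ler_wpM2r ?invr_ge0 ?ler0n//.
  by apply: moment_split => //; exact: ltW.
rewrite ler_wpM2l ?mulr_ge0 ?decay_ge0// nnseries_le_lim//.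
  by move=> n; exact: decay_ge0.
by apply: cvg_decay; lra.
Qed.

Lemma Hinf_cesaro_le p q a k : 0 <= p -> 0 < q -> r = p + q -> Hinf a ->
  cabs (cesaro a k)
    <= C * limn (series (decay (q + 1))) * decay p k * Hinf_norm a.
Proof.
move=> p0 q0 rpq Ha; have M0 := Hinf_norm_ge0 Ha.
rewrite cabsM cabsR// (le_trans (ler_wpM2l _ (Hinf_partial_sum_le k Ha)))//.
rewrite mulrCA mulrC ler_wpM2r//.
(* Moving (k+1)^-q <= (n+1)^-q inside the harmonic sum absorbs its logarithmic growth into a
   convergent series. *)
apply: (@le_trans _ _ (C * decay p k * series (decay (q + 1)) k.+1)).
  rewrite seriesEord /harmonic_sum !mulr_sumr; apply: ler_sum => n _.
  rewrite decayD decay1 mulrA ler_wpM2r ?invr_ge0 ?ler0n//.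
  rewrite (le_trans (m_decay _))// rpq decayD mulrA ler_wpM2l ?mulr_ge0 ?decay_ge0//.
  by rewrite decay_le_index// ?ltW// -ltnS.
rewrite [leRHS](_ : _ = C * decay p k * limn (series (decay (q + 1)))); last by ring.
rewrite ler_wpM2l ?mulr_ge0 ?decay_ge0// nnseries_le_lim//.
  by move=> n; exact: decay_ge0.
by apply: cvg_decay; lra.
Qed.

End MomentOperators.

Theorem theorem33 (R : realType) (mu : {measure set R -> \bar R}) (r : R) :
  (mu (@unit_interval R) < +oo)%E -> 1 < r -> carleson mu r ->
  (* (i) *)
  ((forall a, Hinf a -> forall k, cseries_cvg (Hmu_series mu a k)) /\
   maps_into (@Hinf R) (@AT R) (Hmu mu) /\
   nuclear (@Hinf R) (@Hinf_norm R) (@AT R) (@AT_norm R) (Hmu mu) /\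
   maps_into (@Hinf R) (@AT R) (Cmu mu) /\
   nuclear (@Hinf R) (@Hinf_norm R) (@AT R) (@AT_norm R) (Cmu mu)) /\
  (* (ii) *)
  ((forall a, H2 a -> forall k, cseries_cvg (Hmu_series mu a k)) /\
   maps_into (@H2 R) (@H2 R) (Hmu mu) /\ compact_H2 (Hmu mu) /\
   maps_into (@H2 R) (@H2 R) (Cmu mu) /\ compact_H2 (Cmu mu) /\
   selfadjoint_H2 (Hmu mu)) /\
  (* (iii) *)
  (3%:R / 2%:R < r ->
   maps_into (@H2 R) (@AT R) (Hmu mu) /\
   nuclear (@H2 R) (@H2_norm R) (@AT R) (@AT_norm R) (Hmu mu) /\
   maps_into (@H2 R) (@AT R) (Cmu mu) /\
   nuclear (@H2 R) (@H2_norm R) (@AT R) (@AT_norm R) (Cmu mu)).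
Proof.
move=> mu_fin r1 Hc; have [C C0 mC] := moment_decay mu_fin r1 Hc.
have m0 := moment_ge0 mu_fin; have mle := moment_le mu_fin.
pose m := moment mu.
have cvgHinf a : Hinf a -> forall k, cseries_cvg (hankel_series m a k).
  by move=> Ha k; exact: (Hinf_hankel_cvg m0 C0 mC k r1 Ha).
have cvgH2 a : H2 a -> forall k, cseries_cvg (hankel_series m a k).
  by move=> Ha k; apply: (H2_hankel_cvg m0 C0 mC k (p := r / 2) (q := r / 2)) => //; lra.
have lZ q : 1 < q -> 0 <= limn (series (decay q)).
  move=> q1; apply: nnseries_lim_ge0 => [n|]; [exact: decay_ge0|exact: cvg_decay].
have c_cvg p (B : R) : 1 < p -> cvgn (series (fun k => C * B * decay p k)).
  by move=> p1; apply: cvg_seriesM; exact: cvg_decay.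
have c_ge0 p (B : R) k : 0 <= B -> 0 <= C * B * decay p k.
  by move=> B0; rewrite !mulr_ge0 ?decay_ge0.
split; [split=> //|split; [split=> //|]].
(* p is the midpoint of 1 and r: p > 1 for summability in k, and q = r - p > 0 for the sum over
   n. *)
- pose p := (r + 1) / 2; pose q := (r - 1) / 2.
  have p0 : 0 <= p by rewrite /p; lra.
  have q0 : 0 < q by rewrite /q; lra.
  have rpq : r = p + q by rewrite /p /q; lra.
  have p1 : 1 < p by rewrite /p; lra.
  have Z0 : 0 <= limn (series (decay (q + 1))) by apply: lZ; lra.
  have [HAT Hnuc] : maps_into (@Hinf R) (@AT R) (hankel m) /\
      nuclear (@Hinf R) (@Hinf_norm R) (@AT R) (@AT_norm R) (hankel m).
    apply: (nuclear_coordinates _ (fun k => c_ge0 p _ k Z0) (c_cvg p _ p1)).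
      by move=> a b lam k Xa Xb; exact: (hankel_linear lam k cvgHinf Xa Xb).
    by move=> a k Ha; exact: (Hinf_hankel_le m0 mle C0 mC k p0 q0 rpq r1 Ha).
  have [CAT Cnuc] : maps_into (@Hinf R) (@AT R) (cesaro m) /\
      nuclear (@Hinf R) (@Hinf_norm R) (@AT R) (@AT_norm R) (cesaro m).
    apply: (nuclear_coordinates _ (fun k => c_ge0 p _ k Z0) (c_cvg p _ p1)).
      by move=> a b lam k _ _; exact: cesaro_linear.
    by move=> a k Ha; exact: (Hinf_cesaro_le m0 C0 mC k p0 q0 rpq Ha).
  by [].
- pose q := r / 2.
  have q0 : 0 <= q by rewrite /q; lra.
  have rq : r = q + q by rewrite /q; lra.
  have q1 : 1 < q + q by rewrite -rq.
  have sq_cvg (B : R) : cvgn (series (fun k => (C * B * decay q k) ^+ 2)).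
    under eq_fun do rewrite exprMn.
    by apply: cvg_seriesM; exact: cvg_decay_sqr.
  have [H2H Hcomp] := compact_H2_dominated (fun k => c_ge0 q _ k (sqrtr_ge0 _))
    (sq_cvg _) (fun a k Ha => H2_hankel_le m0 C0 mC k q0 q0 rq q1 Ha).
  have [C2H Ccomp] := compact_H2_dominated (fun k => c_ge0 q _ k (sqrtr_ge0 _))
    (sq_cvg _) (fun a k Ha => H2_cesaro_le m0 C0 mC k q0 q0 rq q1 Ha).
  do 4 split=> //.
  by move=> a b Ha Hb; exact: (H2_hankel_selfadjoint m0 C0 mC r1 Ha Hb).
(* With p - q = 1/2, the conditions p > 1 and q > 1/2 both amount to r > 3/2. *)
- move=> r32; pose p := r / 2 + 4^-1; pose q := r / 2 - 4^-1.
  have p0 : 0 <= p by rewrite /p; lra.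
  have q0 : 0 <= q by rewrite /q; lra.
  have rpq : r = p + q by rewrite /p /q; lra.
  have p1 : 1 < p by rewrite /p; lra.
  have q1 : 1 < q + q by rewrite /q; lra.
  have [HAT Hnuc] : maps_into (@H2 R) (@AT R) (hankel m) /\
      nuclear (@H2 R) (@H2_norm R) (@AT R) (@AT_norm R) (hankel m).
    apply: (nuclear_coordinates _ (fun k => c_ge0 p _ k (sqrtr_ge0 _)) (c_cvg p _ p1)).
      by move=> a b lam k Xa Xb; exact: (hankel_linear lam k cvgH2 Xa Xb).
    by move=> a k Ha; exact: (H2_hankel_le m0 C0 mC k p0 q0 rpq q1 Ha).
  have [CAT Cnuc] : maps_into (@H2 R) (@AT R) (cesaro m) /\
      nuclear (@H2 R) (@H2_norm R) (@AT R) (@AT_norm R) (cesaro m).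
    apply: (nuclear_coordinates _ (fun k => c_ge0 p _ k (sqrtr_ge0 _)) (c_cvg p _ p1)).
      by move=> a b lam k _ _; exact: cesaro_linear.
    by move=> a k Ha; exact: (H2_cesaro_le m0 C0 mC k p0 q0 rpq q1 Ha).
  by [].
Qed.
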